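(* Fix an integer $m\ge 3$ and a real number $\varepsilon>0$. There is an integer $s_0=s_0(m,\varepsilon)$ such that the following holds for all integers $s\ge s_0$. Suppose $\ell$ is an integer with $$1\le \ell\le \left(\frac{m+1}{2m+1}-\varepsilon\right)s,\qquad\text{and let}\qquad n=(m+1)s-\ell.$$ If $\mathcal F\subseteq 2^{[n]}$ satisfies $\nu(\mathcal F)<s$, then $|\mathcal F|\le |P(m,s,\ell)|$. Moreover, equality holds if and only if $\mathcal F=P(m,s,\ell;L)$ for some $L\in\binom{[n]}{\ell-1}$.
   Context: $[n]=\{1,\dots,n\}$; $\binom{X}{k}$ is the family of all $k$-element subsets of $X$. A matching in a family of sets is a collection of pairwise disjoint members, and $\nu(\mathcal F)$ is the size of a largest matching contained in $\mathcal F$ (so $\nu(\mathcal F)<s$ means $\mathcal F$ has no $s$ pairwise disjoint members). With $n=(m+1)s-\ell$ and $L\in\binom{[n]}{\ell-1}$, define $$P(m,s,\ell;L)=\{A\subseteq[n]: |A|+|A\cap L|\ge m+1\}.$$ The size of this family does not depend on the choice of $L$ and is denoted $|P(m,s,\ell)|$. *)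

(* Defs.v *)
From HB Require Import structures.
From mathcomp Require Import all_boot all_order all_algebra.
From mathcomp Require Import reals.

Set Implicit Arguments.
Unset Strict Implicit.
Unset Printing Implicit Defensive.

(** The ground set [n] = {1, ..., n} is represented by ['I_n]. *)

Section Matchings.
Variable T : finType.
Implicit Types F M : {set {set T}}.

(* [trivIset M] allows [set0 \in M]: the empty set is disjoint from every
   other member, and counts as one member of a matching. *)
Definition is_matching F M := (M \subset F) && trivIset M.

Definition matching_number F : nat := \max_(M | is_matching F M) #|M|.

End Matchings.

Definition ground (m s l : nat) : nat := m.+1 * s - l.

Section FamilyP.
Variables m s l : nat.

Definition famP (L : {set 'I_(ground m s l)}) : {set {set 'I_(ground m s l)}} :=
  [set A : {set 'I_(ground m s l)} | m.+1 <= #|A| + #|A :&: L|].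

(* |P(m,s,l)|, computed with L the first l - 1 points; [card_famP] shows that
   any other (l - 1)-element set L gives the same value. *)
Definition sizeP : nat :=
  #|famP [set i : 'I_(ground m s l) | i < l.-1]|.

End FamilyP.

Lemma inj_imset_eq_card (T : finType) (A B : {set T}) :
  #|A| = #|B| -> exists2 f : T -> T, injective f & f @: A = B.
Proof.
move=> eqAB.
pose sq (C : {set T}) := enum C ++ enum (~: C).
have memsq C x : x \in sq C by rewrite mem_cat !mem_enum inE orbN.
have usq C : uniq (sq C).
  rewrite cat_uniq !enum_uniq andbT /=.
  by apply/hasPn => x; rewrite !mem_enum inE.
have szsq C : size (sq C) = #|T| by rewrite size_cat -!cardE cardsC.
pose f x := nth x (sq B) (index x (sq A)).
have ix x : index x (sq A) < size (sq B).
  by rewrite szsq -(szsq A) index_mem memsq.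
have injf : injective f.
  move=> x y; rewrite /f (set_nth_default y) // => /eqP.
  rewrite nth_uniq // => /eqP eqi.
  by rewrite -(nth_index x (memsq A x)) eqi nth_index.
exists f => //; apply/eqP; rewrite eqEcard card_imset // eqAB leqnn andbT.
apply/subsetP => _ /imsetP[x xA ->].
have lti : index x (sq A) < size (enum B).
  by rewrite index_cat mem_enum xA -cardE -eqAB cardE index_mem mem_enum.
by rewrite /f nth_cat lti -mem_enum mem_nth.
Qed.

Lemma card_famP (m s l : nat) (L : {set 'I_(ground m s l)}) :
  #|L| = l.-1 -> #|famP L| = sizeP m s l.
Proof.
have le_famP (L1 L2 : {set 'I_(ground m s l)}) :
    #|L1| = #|L2| -> #|famP L1| <= #|famP L2|.
  move=> /inj_imset_eq_card[f injf <-].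
  rewrite -(card_imset _ (imset_inj injf)); apply/subset_leq_card/subsetP.
  move=> _ /imsetP[A AP ->]; move: AP; rewrite !inE.
  rewrite -imsetI; last by move=> x y _ _; apply: injf.
  by rewrite !card_imset.
move=> cL; rewrite /sizeP; set L0 := [set i | _].
have cL0 : #|L0| = l.-1.
  have le_n : l.-1 <= ground m s l by rewrite -cL -[X in _ <= X]card_ord max_card.
  have -> : L0 = widen_ord le_n @: setT.
    apply/setP => i; rewrite inE; apply/idP/imsetP => [lti | [j _ ->]] /=.
      by exists (Ordinal lti) => //; apply: val_inj.
    exact: ltn_ord.
  rewrite card_imset ?cardsT ?card_ord //.
  by move=> i j /(congr1 val) /= /val_inj.
by apply/eqP; rewrite eqn_leq !le_famP // cL cL0.
Qed.

(* Main.v *)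
Require Import Defs.
From HB Require Import structures.
From mathcomp Require Import all_boot all_order all_algebra all_fingroup.
From mathcomp Require Import reals.
From mathcomp Require Import zify ring lra.
Import Order.TTheory GRing.Theory Num.Theory.

Set Implicit Arguments.
Unset Strict Implicit.
Unset Printing Implicit Defensive.

(** Put n = (m+1)s - l and give a set A the weight |A| + |A :&: L|, where
    |L| = l - 1.  The whole ground set has weight (m+1)s - 1, so s disjoint sets
    cannot all have weight at least m + 1: this is why the family [heavy m L]
    has no s disjoint members.  The converse compares the sets missing from a
    family F with those missing from a heavy family, whose number is of order
    s^m and comes mainly from the m-sets disjoint from L.

    Shifting preserves the size of F and creates no matching, so F is first taken
    shifted ([has_matching_shift], [index_sum_shift]); L is then the initial segment
    of length l - 1.  Suppose F is at least as large as [heavy m L].  Then F misses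
    only O(s^m) of the (m+1)-sets.

    Averaging over random disjoint blocks ([averaging]) turns this into a bound on
    matchings inside layer m.  If layer m contains l + (m+1)K disjoint sets, the
    remaining points can be cut into K blocks of size m + 1 more than are needed to
    complete a matching of size s, so more than K blocks of every such partition are
    missing ([missing_ge_of_matching]).  For a large constant K this contradicts the
    bound O(s^m), so layer m has matching number less than l + O(1).

    Frankl's argument for the Erdos matching problem, run with some room to spare,
    bounds layer m ([missing_layer_stability]): with no l disjoint m-sets, F misses
    at least as many m-sets as the heavy family, and 1/m times the number of
    missing m-sets with exactly one point in L in addition.  Applied with
    l + O(1) in place of l it loses only O(s^(m-1)) sets, whereas l disjoint m-sets
    in F would force a positive proportion of s^m missing (m+1)-sets.  Hence layer m
    has matching number less than l ([no_layer_matching]), and the bound applies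
    with l itself.

    What F can still gain are light sets, of weight at most m, with fewer than m
    points: O(s^(m-1)) of them.  If r of them are disjoint, putting them in a
    partition of the ground set leaves r - 1 points over, and these repair r - 1
    missing blocks; so the missing m-sets with one point in L number at least
    about r times a constant times s^(m-1) ([light_sets_force_missing]).  For r a
    large constant this exceeds all possible gains.  So the light sets are covered
    by O(1) points, there are O(s^(m-2)) of them, and then the estimate for r = 1
    excludes even one light set.  Thus F is contained in [heavy m L], hence equal to
    it ([shifted_extremal]).

    Uniqueness survives undoing a shift: a family whose shift is heavy is itself
    heavy, otherwise two disjoint members straddling the shifted pair extend to a
    matching of size s ([unshift_heavy]).  A family containing the empty set is
    strictly smaller than another family without s disjoint members
    ([larger_family]). *)

(** * Matchings and disjoint blocks *)

Section Matchings.
Variable T : finType.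
Implicit Types (F G : {set {set T}}) (A B Z : {set T}).

Definition disjoint_family (I : finType) (M : I -> {set T}) :=
  forall i j, i != j -> [disjoint M i & M j].

(** Members are indexed and repetitions of the empty set are allowed, so a family
    that contains the empty set has matchings of every size. *)
Definition has_matching F r :=
  exists2 M : 'I_r -> {set T}, (forall i, M i \in F) & disjoint_family M.

Lemma has_matching_in F r (I : finType) (D : {pred I}) (M : I -> {set T}) :
  r <= #|D| -> {in D, forall i, M i \in F} ->
  {in D &, forall i j, i != j -> [disjoint M i & M j]} ->
  has_matching F r.
Proof.
move=> le_r MF MD; exists (fun i => M (enum_val (widen_ord le_r i))).
  by move=> i; apply/MF/enum_valP.
move=> i j neq_ij; apply: MD; try exact: enum_valP.
by apply: contra_neq neq_ij => /enum_val_inj /(congr1 val) /= /val_inj.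
Qed.

Lemma has_matchingS F G r : F \subset G -> has_matching F r -> has_matching G r.
Proof. by move=> /subsetP sFG [M MF MD]; exists M => // i; apply/sFG. Qed.

(** A finite search, which lets [cover_of_no_matching] pick a maximum matching. *)
Lemma has_matchingP F r :
  reflect (has_matching F r) [exists M : {ffun 'I_r -> {set T}},
    [forall i, M i \in F] && [forall i, forall j, (i != j) ==> [disjoint M i & M j]]].
Proof.
apply: (iffP existsP) => [[M /andP[/forallP MF /forallP MD]]|[M MF MD]].
  by exists M => // i j; have /forallP/(_ j)/implyP := MD i.
exists [ffun i => M i]; apply/andP; split; apply/forallP => i; first by rewrite ffunE.
by apply/forallP => j; rewrite !ffunE; apply/implyP/MD.
Qed.

Lemma disjoint_familyP (I : finType) (V : I -> {set T}) :
  (forall i j x, x \in V i -> x \in V j -> i = j) -> disjoint_family V.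
Proof.
move=> VP i j neq_ij; rewrite disjoints_subset; apply/subsetP => x xi.
by rewrite inE; apply: contra neq_ij => xj; apply/eqP; apply: VP xi xj.
Qed.

Lemma disjoint_family_eq (I : finType) (V : I -> {set T}) i j x :
  disjoint_family V -> x \in V i -> x \in V j -> i = j.
Proof.
move=> Vd xi xj; apply/eqP/negPn/negP => neq_ij.
by have := disjointFr (Vd i j neq_ij) xi; rewrite xj.
Qed.

Lemma disjoint_family_perm (I : finType) (V : I -> {set T}) (p : {perm T}) :
  disjoint_family V -> disjoint_family (fun i => p @: V i).
Proof.
move=> Vd i j neq_ij; rewrite imset_disjoint; first exact: Vd.
exact: perm_inj.
Qed.

Lemma perm_on_imset Z A (p : {perm T}) :
  perm_on Z p -> A \subset Z -> p @: A \subset Z.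
Proof.
move=> pZ sAZ; apply/subsetP => _ /imsetP[u uA ->].
by rewrite perm_closed // (subsetP sAZ).
Qed.

Lemma card_sum_pred (I J : finType) (D : {pred I + J}) :
  #|D| = #|[set i | inl i \in D]| + #|[set j | inr j \in D]|.
Proof. by rewrite -[LHS]sum1_card big_sumType /= !sum1dep_card. Qed.

Lemma blocks_exist (I : finType) (k : I -> nat) Z :
  \sum_i k i <= #|Z| ->
  exists2 e : I -> {set T},
    forall i, e i \subset Z /\ #|e i| = k i & disjoint_family e.
Proof.
suff H (r : seq I) : uniq r -> \sum_(i <- r) k i <= #|Z| ->
  exists2 e : I -> {set T},
    forall i, e i \subset Z /\ (i \in r -> #|e i| = k i)
    & (forall i, i \notin r -> e i = set0) /\ disjoint_family e.
  move=> le_k; have [||e eP [_ eD]] := H (index_enum I); rewrite ?index_enum_uniq //.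
  by exists e => // i; have [-> ->] := eP i; rewrite ?mem_index_enum.
elim: r => [_ _|i0 r IHr /= /andP[i0r ur]].
  exists (fun=> set0) => [i|]; first by rewrite sub0set.
  by split=> // i j _; rewrite disjoints_subset sub0set.
rewrite big_cons => le_k.
have [|e eP [e0 eD]] := IHr ur; first exact: leq_trans (leq_addl _ _) le_k.
pose U := \bigcup_(i in r) e i.
have sUZ : U \subset Z by apply/bigcupsP => i _; have [] := eP i.
have cU : #|U| <= \sum_(i <- r) k i.
  rewrite /U (eq_bigl (mem r)) // -big_uniq //=.
  rewrite (eq_big_seq (fun i => #|e i|)); last by move=> i ir; have [_ ->] := eP i.
  elim/big_rec2: _ => [|i x y _ le_xy]; first by rewrite cards0.
  by apply: leq_trans (leq_card_setU _ _) _; rewrite leq_add2l.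
have [B sB cB] : exists2 B : {set T}, B \subset Z :\: U & #|B| = k i0.
  have : k i0 <= #|Z :\: U|.
    by rewrite cardsD (setIidPr sUZ) leq_subRL ?subset_leq_card //; lia.
  move=> le_kB; exists [set x in take (k i0) (enum (Z :\: U))].
    by apply/subsetP => x; rewrite inE => /mem_take; rewrite mem_enum.
  by rewrite cardsE (card_uniqP _) ?take_uniq ?enum_uniq // size_takel // -cardE.
have BU i : i \in r -> [disjoint B & e i].
  move=> ir; rewrite disjoints_subset; apply: subset_trans sB _.
  by rewrite setDE subIset // setCS (bigcup_sup i) ?orbT.
exists (fun i => if i == i0 then B else e i) => [i|].
  have [->|ne] := eqVneq i i0; last by rewrite inE (negPf ne); exact: eP.
  by split=> [|_ //]; apply: subset_trans sB _; apply: subsetDl.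
split=> [i|i j]; first by rewrite inE negb_or => /andP[/negPf-> /e0].
have d0 (A : {set T}) : [disjoint A & set0].
  by rewrite disjoint_sym disjoints_subset sub0set.
have BU' h : [disjoint B & e h].
  by have [/BU //|/e0->] := boolP (h \in r).
move=> neq_ij /=; case: (altP (i =P i0)) neq_ij => [->|_] neq_ij.
  by rewrite eq_sym (negPf neq_ij).
case: (altP (j =P i0)) neq_ij => [_|_] neq_ij; first by rewrite disjoint_sym.
exact: eD.
Qed.

(** The union of a maximum matching meets every member. *)
Lemma cover_of_no_matching G r k :
  (forall A, A \in G -> #|A| <= k) -> ~ has_matching G r ->
  exists2 C : {set T}, #|C| <= r * k & forall A, A \in G -> ~~ [disjoint A & C].
Proof.
move=> Gk; elim: r => [|r IHr] Gr.
  have f0 (i : 'I_0) : {set T} by case: i.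
  by case: Gr; exists f0 => [[]|[]].
have [|/has_matchingP/IHr[C le_C CP]] := boolP [exists M : {ffun 'I_r -> {set T}},
    [forall i, M i \in G] && [forall i, forall j, (i != j) ==> [disjoint M i & M j]]];
  last by exists C => //; apply: leq_trans le_C _; rewrite leq_mul2r leqnSn orbT.
case/has_matchingP=> M MG MD; exists (\bigcup_i M i).
  apply: (@leq_trans (r * k)); last by rewrite leq_mul2r leqnSn orbT.
  rewrite -sum1_card partition_disjoint_bigcup //= -[X in X * _]card_ord -sum_nat_const.
  by apply: leq_sum => i _; rewrite sum1_card; apply: Gk.
move=> A AG; apply/negP => dA; apply: Gr.
pose V (x : option 'I_r) := if x is Some i then M i else A.
apply: (@has_matching_in _ _ _ predT V); first by rewrite card_option card_ord.
  by move=> [i|] _; [apply: MG|].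
have dAi i : [disjoint A & M i] by move/bigcup_disjointP: dA; apply.
move=> [i|] [j|] _ _ //=; [by move=> neq; apply: MD; apply: contra neq => /eqP->|].
by rewrite disjoint_sym.
Qed.

End Matchings.

(** * Averaging over permutations *)

Section Averaging.
Variable T : finType.
Implicit Types (F : {set {set T}}) (A B Z : {set T}).

Definition slice F Z k := [set A in F | (A \subset Z) && (#|A| == k)].

(** Each transposition of a point of A outside B with a point of B outside A
    brings A closer to B. *)
Lemma perm_on_move Z A B : A \subset Z -> B \subset Z -> #|A| = #|B| ->
  exists2 p : {perm T}, perm_on Z p & p @: A = B.
Proof.
move: {2}#|A :\: B| (leqnn #|A :\: B|) => d; elim: d A => [|d IHd] A.
  rewrite leqn0 cards_eq0 setD_eq0 => sAB _ _ eqAB; exists 1%g; first exact: perm_on1.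
  have -> : A = B by apply/eqP; rewrite eqEcard sAB eqAB leqnn.
  by rewrite (eq_imset _ (@perm1 T)) imset_id.
move=> le_d sAZ sBZ eqAB.
have [sAB|] := boolP (A \subset B).
  by apply: IHd => //; rewrite (eqP (_ : A :\: B == set0)) ?cards0 // setD_eq0.
case/subsetPn=> x xA xB.
have [y yB yA] : exists2 y, y \in B & y \notin A.
  apply/subsetPn; apply: contra xB => sBA.
  by have -> : B = A by apply/eqP; rewrite eqEcard sBA eqAB leqnn.
have neq_xy : x != y by apply: contraNneq yA => <-.
have xZ := subsetP sAZ _ xA; have yZ := subsetP sBZ _ yB.
have pZ : perm_on Z (tperm x y).
  by apply/subsetP => z; rewrite inE; case: tpermP => [->|->|]; rewrite ?eqxx.
have [||||p pon pE] := IHd (tperm x y @: A) => //.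
- rewrite -ltnS; apply: leq_trans le_d.
  have : tperm x y @: A :\: B \proper A :\: B; last exact: proper_card.
  apply/properP; split.
    apply/subsetP => z; rewrite !inE => /andP[zB /imsetP[u uA zE]].
    move: zB; rewrite zE; case: tpermP => [_|uy|_ _ ->]; rewrite ?yB ?uA //.
    by rewrite -uy uA in yA.
  exists x; rewrite !inE ?xB ?xA //=; apply/imsetP => -[u uA].
  case: tpermP => [_ /eqP|uy|/eqP ux _ xu]; first by rewrite (negPf neq_xy).
    by rewrite -uy uA in yA.
  by rewrite xu eqxx in ux.
- apply/subsetP => _ /imsetP[u uA ->].
  by rewrite perm_closed //; apply: (subsetP sAZ).
- by rewrite card_imset //; apply: perm_inj.
exists (tperm x y * p)%g; first exact: perm_onM.
by rewrite -pE -imset_comp; apply: eq_imset => z /=; rewrite permM.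
Qed.

(** The image of a fixed k-subset of Z under a random permutation of Z is uniformly
    distributed: moving the target by a permutation of Z is a bijection between
    the permutations that reach two given targets. *)
Lemma card_perm_slice F Z k (e : {set T}) : e \subset Z -> #|e| = k ->
  #|[set p : {perm T} | perm_on Z p & p @: e \in F]| * 'C(#|Z|, k) =
  #|slice F Z k| * #|[set p : {perm T} | perm_on Z p]|.
Proof.
move=> eZ ek.
pose cnt (A : {set T}) := #|[set p : {perm T} | perm_on Z p & p @: e == A]|.
have cntE A : A \subset Z -> #|A| = k -> cnt A = cnt e.
  move=> AZ Ak; have [|q qZ qE] := perm_on_move eZ AZ; first by rewrite ek Ak.
  rewrite /cnt -[RHS](card_imset _ (mulIg q)); apply: eq_card => p.
  rewrite inE; apply/andP/imsetP => [[pZ /eqP pE]|[r]].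
    exists (p * q^-1)%g; last by rewrite mulgKV.
    rewrite inE perm_onM ?perm_onV //=; apply/eqP/(imset_inj (@perm_inj _ q)).
    by rewrite qE -imset_comp -pE; apply: eq_imset => z /=; rewrite permM permKV.
  rewrite inE => /andP[rZ /eqP rE] ->; rewrite perm_onM //; split=> //; apply/eqP.
  by rewrite -qE -{2}rE -imset_comp; apply: eq_imset => z /=; rewrite permM.
have cntF (H : {set {set T}}) :
    #|[set p : {perm T} | perm_on Z p & p @: e \in H]| = #|slice H Z k| * cnt e.
  rewrite -sum1_card (partition_big (fun p : {perm T} => p @: e) (mem (slice H Z k))) /=.
    rewrite -sum_nat_const; apply: eq_bigr => A; rewrite !inE => /and3P[AH AZ /eqP Ak].
    rewrite sum1dep_card -(cntE A) //; apply: eq_card => p; rewrite !inE -!andbA.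
    by case: eqP => [->|]; rewrite ?AH ?andbF.
  move=> p; rewrite !inE => /andP[pZ ->]; rewrite card_imset ?ek ?eqxx ?andbT //=.
    by apply/subsetP => _ /imsetP[u ue ->]; rewrite perm_closed // (subsetP eZ).
  exact: perm_inj.
have -> : #|[set p : {perm T} | perm_on Z p]| = 'C(#|Z|, k) * cnt e.
  have := cntF setT; rewrite -cards_draws.
  rewrite (_ : slice setT Z k = [set A : {set T} | A \subset Z & #|A| == k]); last first.
    by apply/setP => A; rewrite !inE.
  by move=> <-; apply: eq_card => p; rewrite !inE andbT.
by rewrite cntF -!mulnA [cnt e * _]mulnC.
Qed.

Definition density F Z k : rat := (#|slice F Z k|%:R / 'C(#|Z|, k)%:R)%R.

(** A linear inequality that holds for every placement of a system of blocks in Z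
    passes to the densities, by linearity of expectation; the blocks need not be
    independent. *)
Lemma averaging (J : finType) (c : J -> rat) (c0 : rat) Z (k : J -> nat)
    (e : J -> {set T}) (H : J -> {set {set T}}) :
  (forall j, e j \subset Z /\ #|e j| = k j) ->
  (forall p : {perm T}, perm_on Z p ->
     (c0 <= \sum_j c j * (p @: e j \in H j)%:R)%R) ->
  (c0 <= \sum_j c j * density (H j) Z (k j))%R.
Proof.
move=> eP avg; pose S := [set p : {perm T} | perm_on Z p].
have S_gt0 : (0 < #|S|%:R :> rat)%R.
  by rewrite ltr0n; apply/card_gt0P; exists 1%g; rewrite inE perm_on1.
rewrite -(ler_pM2l S_gt0).
have -> : (#|S|%:R * (\sum_j c j * density (H j) Z (k j)) =
    \sum_(p in S) \sum_j c j * (p @: e j \in H j)%:R)%R.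
  rewrite exchange_big mulr_sumr; apply: eq_bigr => j _ /=.
  rewrite -mulr_sumr mulrCA; congr (_ * _)%R.
  have [ej kj] := eP j.
  have C_neq0 : ('C(#|Z|, k j)%:R != 0 :> rat)%R.
    by rewrite pnatr_eq0 -lt0n bin_gt0 -kj subset_leq_card.
  have cE : \sum_(p in S) (p @: e j \in H j) =
      #|[set p : {perm T} | perm_on Z p & p @: e j \in H j]|.
    rewrite -sum1dep_card big_mkcondr /=.
    by apply: eq_big => p; rewrite ?inE // => _; case: (_ \in _).
  rewrite -natr_sum cE /density; apply: (mulIf C_neq0).
  by rewrite -mulrA mulfVK // -!natrM card_perm_slice // mulnC.
rewrite -sum1_card natr_sum mulr_suml; apply: ler_sum => p pS; rewrite mul1r.
by apply: avg; rewrite inE in pS.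
Qed.
End Averaging.

(** * Counting estimates *)

Lemma ffact_le_exp n k : n ^_ k <= n ^ k.
Proof.
elim: k => [|k IHk]; first by rewrite ffactn0.
by rewrite ffactnSr expnSr leq_mul // leq_subr.
Qed.

Lemma bin_le_exp n k : 'C(n, k) <= n ^ k.
Proof.
apply: leq_trans (ffact_le_exp n k).
by rewrite -bin_ffact leq_pmulr // fact_gt0.
Qed.

Lemma exp_le_bin n k : 2 * k <= n -> n ^ k <= 'C(n, k) * (k`! * 2 ^ k).
Proof.
rewrite mulnA bin_ffact; elim: k => [|k IHk] le_kn; first by rewrite ffactn0.
rewrite ffactnSr !expnSr mulnACA leq_mul ?IHk //; lia.
Qed.

Lemma leq_exp_base a b k : a <= b -> a ^ k <= b ^ k.
Proof. by move=> le_ab; case: k => // k; rewrite leq_exp2r. Qed.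

Lemma bin_add_le b c k : 'C(b + c, k.+1) <= 'C(b, k.+1) + c * (b + c) ^ k.
Proof.
elim: c => [|c IHc]; first by rewrite addn0 leq_addr.
rewrite addnS binS; apply: leq_trans (leq_add IHc (bin_le_exp _ _)) _.
rewrite -addnA leq_add2l mulSn addnC.
by apply: leq_add; rewrite ?leq_mul2l leq_exp_base ?orbT.
Qed.

Lemma card_lt_size_le (T : finType) k : 0 < #|T| ->
  #|[set A : {set T} | #|A| < k.+1]| <= k.+1 * #|T| ^ k.
Proof.
move=> T_gt0; elim: k => [|k IHk].
  rewrite expn0 muln1 -[X in _ <= X](cards1 (set0 : {set T})).
  apply/subset_leq_card/subsetP => A.
  by rewrite !inE ltnS leqn0 cards_eq0.
have -> : [set A : {set T} | #|A| < k.+2] =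
    [set A : {set T} | #|A| < k.+1] :|: [set A : {set T} | #|A| == k.+1].
  by apply/setP => A; rewrite !inE ltnS leq_eqVlt orbC.
apply: leq_trans (leq_card_setU _ _) _; rewrite card_draws mulSn addnC.
apply: leq_add; first exact: bin_le_exp.
apply: leq_trans IHk _; rewrite leq_mul2l expnS leq_pmull ?orbT //.
Qed.

(** Fixing one point of the cover saves one factor of the size of the ground set. *)
Lemma card_le_cover (T : finType) (G : {set {set T}}) (C : {set T}) k : 0 < #|T| ->
  (forall A, A \in G -> #|A| < k.+2 /\ ~~ [disjoint A & C]) ->
  #|G| <= #|C| * (k.+1 * #|T| ^ k).
Proof.
move=> T_gt0 GP; pose S (x : T) := [set A in G | x \in A].
apply: (@leq_trans #|\bigcup_(x in C) S x|).
  apply/subset_leq_card/subsetP => A AG.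
  have [_] := GP A AG; rewrite -setI_eq0 => /set0Pn[x]; rewrite inE => /andP[xA xC].
  by apply/bigcupP; exists x; rewrite // inE AG.
rewrite -sum_nat_const.
apply: (@big_ind2 _ _ (fun (B : {set {set T}}) c => #|B| <= c)) => [|B c D d le1 le2|x _].
- by rewrite cards0.
- by apply: leq_trans (leq_card_setU _ _) _; apply: leq_add.
apply: leq_trans (card_lt_size_le k T_gt0).
rewrite /S -[X in X <= _](@card_in_imset _ _ (fun A => A :\ x)); last first.
  move=> A B; rewrite !inE => /andP[_ xA] /andP[_ xB] /(congr1 (setU [set x])).
  by rewrite !setD1K.
apply/subset_leq_card/subsetP => _ /imsetP[A + ->]; rewrite !inE => /andP[AG xA].
by have [+ _] := GP A AG; rewrite (cardsD1 x) xA add1n.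
Qed.

Lemma card_disjoint_le (T : finType) (A B C : {set T}) :
  A \subset C -> B \subset C -> A :&: B = set0 -> #|A| + #|B| <= #|C|.
Proof.
move=> sAC sBC dAB; rewrite -cardsUI dAB cards0 addn0.
by rewrite subset_leq_card // subUset sAC.
Qed.

Lemma card_initial n k : k <= n -> #|[set i : 'I_n | i < k]| = k.
Proof.
move=> le_kn; rewrite -[RHS]card_ord -(@card_imset _ _ (widen_ord le_kn) predT); last first.
  by move=> i j /(congr1 val) /= /val_inj.
apply: eq_card => i; rewrite inE; apply/idP/imsetP => [lt_ik|[j _ ->]]; last by rewrite /= ltn_ord.
by exists (Ordinal lt_ik) => //; apply: val_inj.
Qed.

(** A set with exactly one point r in L and its other points in Z is recovered from
    r and the rest, so the links of the points of L count such sets at most once. *)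
Lemma star_slices_le (T : finType) (H : {set {set T}}) (L Z : {set T}) k :
  [disjoint L & Z] ->
  \sum_(r in L) #|slice [set E : {set T} | r |: E \in H] Z k| <=
  #|[set A in H | (#|A| == k.+1) && (#|A :&: L| == 1)]|.
Proof.
move=> dLZ; pose U (r : T) := if r \in L then
  [set r |: E | E in slice [set E : {set T} | r |: E \in H] Z k] else set0.
have ZL (E : {set T}) r : E \subset Z -> r \in L -> r \notin E.
  move=> sEZ rL; apply/negP => /(subsetP sEZ).
  by rewrite (disjointFr dLZ rL).
have memUL r A : A \in U r -> r \in L by rewrite /U; case: ifP => // _; rewrite inE.
have UP r A : A \in U r -> exists2 E : {set T},
    [/\ A = r |: E, r |: E \in H & #|E| = k] & E \subset Z.
  move=> Ar; have rL := memUL _ _ Ar; move: Ar; rewrite /U rL => /imsetP[E].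
  by rewrite !inE => /and3P[EH sEZ /eqP cE] ->; exists E.
have UI r A : A \in U r -> A :&: L = [set r].
  move=> Ar; have rL := memUL _ _ Ar; have [E [-> _ _] sEZ] := UP _ _ Ar.
  apply/setP => x; rewrite !inE; case: eqP => [->|_] /=; first by rewrite rL.
  by apply/negP => /andP[xE xL]; have := ZL E x sEZ xL; rewrite xE.
have -> : \sum_(r in L) #|slice [set E : {set T} | r |: E \in H] Z k| =
    #|\bigcup_r U r|.
  rewrite -sum1_card partition_disjoint_bigcup /=; last first.
    move=> r r' neq_r; rewrite disjoints_subset; apply/subsetP => A Ar; rewrite inE.
    apply/negP => Ar'; case/eqP: neq_r; apply/set1P.
    by rewrite -(UI _ _ Ar') (UI _ _ Ar) set11.
  rewrite big_mkcond; apply: eq_bigr => r _; rewrite sum1_card /U.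
  case: ifP => rL; last by rewrite cards0.
  rewrite card_in_imset // => A B; rewrite !inE.
  move=> /and3P[_ sA _] /and3P[_ sB _] /(congr1 (fun A => A :\ r)).
  by rewrite !setU1K //; apply: ZL.
apply/subset_leq_card/bigcupsP => r _; apply/subsetP => A Ar.
rewrite inE (UI _ _ Ar) cards1 andbT; have [E [-> -> cE] sEZ] := UP _ _ Ar.
by rewrite cardsU1 (ZL E) ?cE ?eqxx // (memUL _ _ Ar).
Qed.

(** * Heavy sets and missing sets *)

Definition heavy (T : finType) m (L : {set T}) :=
  [set A : {set T} | m.+1 <= #|A| + #|A :&: L|].

Definition missing (T : finType) (F : {set {set T}}) k :=
  [set A : {set T} | (A \notin F) && (#|A| == k)].

Definition missing_star (T : finType) (F : {set {set T}}) (L : {set T}) k :=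
  [set A : {set T} | [&& A \notin F, #|A| == k & #|A :&: L| == 1]].

(** * Shifting *)

Section Shifting.
Variable n : nat.
Implicit Types (F : {set {set 'I_n}}) (A B : {set 'I_n}) (i j x : 'I_n).

(** On a set containing j but not i this is the replacement of j by i
    ([swapE]); as an involution on all sets it makes the counting symmetric. *)
Definition swap i j A := tperm i j @: A.

Lemma in_swap i j A x : (x \in swap i j A) = (tperm i j x \in A).
Proof. by rewrite -{1}[x](tpermK i j) mem_imset //; apply: perm_inj. Qed.

Lemma swapK i j : involutive (swap i j).
Proof. by move=> A; apply/setP => x; rewrite !in_swap tpermK. Qed.

Lemma swap_id i j A : (i \in A) = (j \in A) -> swap i j A = A.
Proof. by move=> eqA; apply/setP => x; rewrite in_swap; case: tpermP => // ->. Qed.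

Lemma swapE i j A : j \in A -> i \notin A -> swap i j A = i |: (A :\ j).
Proof.
move=> jA iA; apply/setP => x; rewrite in_swap !inE.
case: tpermP => [->|->|/eqP/negPf-> /eqP/negPf->] //; rewrite ?eqxx ?jA //=.
by rewrite orbF (negPf iA); apply/esym/negbTE; apply: contraNneq iA => <-.
Qed.

Definition shifted F := forall i j A, i < j -> A \in F -> j \in A -> i \notin A ->
  i |: (A :\ j) \in F.

(** The (i, j)-shift, described through the pairs A, [swap i j A]: if only one
    member of a pair belongs to F, the shift keeps the one containing i. *)
Definition shift i j F := [set A : {set 'I_n} |
  if (i \in A) == (j \in A) then A \in F
  else if j \in A then (A \in F) && (swap i j A \in F)
  else (A \in F) || (swap i j A \in F)].

Lemma sum_swap i j (f : {set 'I_n} -> nat) : \sum_A f A = \sum_A f (swap i j A).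
Proof. exact: (reindex_inj (inv_inj (swapK i j))). Qed.

(** Each pair A, [swap i j A] contributes the same number of members to both
    families, so both sides agree after doubling. *)
Lemma card_shift i j F : #|shift i j F| = #|F|.
Proof.
have dE (G : {set {set 'I_n}}) :
    #|G|.*2 = \sum_(A : {set 'I_n}) ((A \in G) + (swap i j A \in G)).
  rewrite big_split /= -(sum_swap i j (fun A => A \in G : nat)) addnn -sum1_card.
  by rewrite big_mkcond.
apply: double_inj; rewrite !dE; apply: eq_bigr => A _; rewrite !inE swapK !in_swap tpermL tpermR.
have [eqij|] := altP (i \in A =P (j \in A)).
    by rewrite (swap_id eqij) eqij eqxx.
by case: (j \in A); case: (i \in A); case: (A \in F); case: (swap _ _ _ \in F).
Qed.

(** If some member of the matching is new, it contains i but not j, so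
    the others avoid i.  Swapping i and j in all of them leads back to F: the new
    member comes from F, and a member containing j was kept because its swap is in
    F too. *)
Lemma has_matching_shift i j F r : has_matching (shift i j F) r -> has_matching F r.
Proof.
case=> M MS MD; have [/forallP|] := boolP [forall a, M a \in F]; first by exists M.
case/forallPn=> a MaF; have := MS a; rewrite inE (negPf MaF).
have [//|neq] := altP (i \in M a =P (j \in M a)).
case jMa: (j \in M a) => //= sMa.
have iMa : i \in M a by move: neq; rewrite jMa; case: (i \in M a).
exists (fun c => swap i j (M c)) => [c|c d neq_cd].
  have [->//|neq_ca] := eqVneq c a.
  have iMc : i \notin M c.
    by have /disjointFr/(_ iMa)-> : [disjoint M a & M c] by apply: MD; rewrite eq_sym.
  have := MS c; rewrite inE (negPf iMc); case jMc: (j \in M c) => /=.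
    by case/andP.
  by rewrite swap_id // jMc (negPf iMc).
rewrite imset_disjoint; first exact: MD.
exact: perm_inj.
Qed.

(** Potential that decreases under proper shifts and so bounds their number. *)
Definition index_sum F := \sum_(A in F) \sum_(x in A) val x.

Lemma index_sum_shift i j F A : i < j -> A \in F -> j \in A -> i \notin A ->
  swap i j A \notin F -> index_sum (shift i j F) < index_sum F.
Proof.
move=> lt_ij AF jA iA sAF; rewrite -ltn_double.
pose w (B : {set 'I_n}) := \sum_(x in B) val x.
have dE (G : {set {set 'I_n}}) : (index_sum G).*2 =
    \sum_(B : {set 'I_n}) ((if B \in G then w B else 0) +
      (if swap i j B \in G then w (swap i j B) else 0)).
  rewrite big_split /= -(sum_swap i j (fun A => if A \in G then w A else 0)) addnn.
  by rewrite /index_sum big_mkcond.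
rewrite !dE.
have sw (B : {set 'I_n}) : j \in B -> i \notin B -> w (swap i j B) < w B.
  move=> jB iB; rewrite swapE // /w big_setU1 ?inE ?(negPf iB) ?andbF //=.
  by rewrite (big_setD1 _ jB) /= ltn_add2r.
have le B : (if B \in shift i j F then w B else 0) +
    (if swap i j B \in shift i j F then w (swap i j B) else 0) <=
    (if B \in F then w B else 0) +
    (if swap i j B \in F then w (swap i j B) else 0).
  rewrite !inE swapK !in_swap tpermL tpermR.
  have [eqij|] := altP (i \in B =P (j \in B)).
    by rewrite (swap_id eqij) eqij eqxx.
  move=> neq.
  have := sw B; have := sw (swap i j B); rewrite !in_swap tpermL tpermR swapK.
  move: neq; case: (j \in B); case: (i \in B) => //= _;
    case: (B \in F); case: (swap _ _ _ \in F) => //=; lia.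
rewrite (bigD1 A) //= [X in _ < X](bigD1 A) //= -addSn leq_add //; last first.
  by apply: leq_sum => B _; apply: le.
rewrite !inE swapK !in_swap tpermL tpermR jA (negPf iA) AF (negPf sAF) /=.
by have := sw A jA iA; rewrite /w; lia.
Qed.

End Shifting.

(** * Shadows of shifted families *)

Section Shadow.
Variable n : nat.
Implicit Types (G : {set {set 'I_n}}) (A B : {set 'I_n}).

Definition shadow G := [set B : {set 'I_n} | [exists x, (x \notin B) && (x |: B \in G)]].

Lemma shadowP G B :
  reflect (exists2 x, x \notin B & x |: B \in G) (B \in shadow G).
Proof.
rewrite inE; apply: (iffP existsP) => [[x /andP[]]|[x xB xBG]]; first by exists x.
by exists x; rewrite xB.
Qed.

(** Double count the pairs of a member and one of its points. *)
Lemma shadow_double_count G (I : {set 'I_n}) k :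
  (forall A, A \in G -> A \subset I /\ #|A| = k) ->
  #|G| * k <= #|shadow G| * (#|I| - k.-1).
Proof.
move=> GP; rewrite -!sum_nat_const.
have -> : \sum_(A in G) k = \sum_(A in G) \sum_(x in A) 1.
  by apply: eq_bigr => A /GP[_ <-]; rewrite sum1_card.
rewrite (exchange_big_dep predT) //=.
have le_B B : B \in shadow G -> \sum_(x in I :\: B) 1 = #|I| - k.-1.
  case/shadowP=> x xB /GP[sI cA]; have := cA; rewrite cardsU1 xB => cB.
  rewrite sum1_card cardsD (setIidPr _) -?cB //.
  by apply: subset_trans sI; apply: subsetUr.
rewrite -(eq_bigr _ le_B) [X in _ <= X](exchange_big_dep predT) //=.
apply: leq_sum => x _; rewrite !sum1dep_card.
rewrite -(@card_in_imset _ _ (fun A => A :\ x)); last first.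
  by move=> A B; rewrite !inE => /andP[_ xA] /andP[_ xB] /(congr1 (setU [set x]));
    rewrite !setD1K.
apply/subset_leq_card/subsetP => _ /imsetP[A + ->]; rewrite !inE => /andP[AG xA].
rewrite eqxx /=; apply/andP; split.
  by apply/existsP; exists x; rewrite !inE eqxx setD1K.
by have [/subsetP-> //] := GP A AG.
Qed.

(** Frankl's form of Katona's shadow theorem, for shifted families without r + 1
    disjoint members.  On fewer than k(r+1) points it is the double count above.
    On more points, split by the last point x: both the members avoiding x and
    the link of x satisfy the hypotheses on a smaller ground set, and their shadows
    give disjoint parts of the shadow.  The link has no r + 1 disjoint members
    because there is room to complete them with distinct points, to which x can
    be shifted. *)
Lemma shadow_card_ge k r (G : {set {set 'I_n}}) a b : 0 < k ->
  (forall A, A \in G -> #|A| = k /\ forall x, x \in A -> a <= x < b) ->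
  (forall (i j : 'I_n) A, a <= i -> i < j -> A \in G -> j \in A -> i \notin A ->
     i |: (A :\ j) \in G) ->
  ~ has_matching G r.+1 ->
  #|G| <= r * #|shadow G|.
Proof.
elim: b k G => [|b IHb] k G k_gt0 GP Gsh Gr.
  suff -> : G = set0 by rewrite cards0.
  apply/setP => A; rewrite inE; apply/negP => /GP[cA].
  have /card_gt0P[x xA] : 0 < #|A| by rewrite cA.
  by move=> /(_ x xA); rewrite ltn0 andbF.
pose I := [set x : 'I_n | a <= x < b.+1].
have GI A : A \in G -> A \subset I /\ #|A| = k.
  by move=> /GP[-> Aab]; split=> //; apply/subsetP => x /Aab; rewrite inE.
have [small|large] := ltnP #|I| (k * r.+1).
  have := shadow_double_count GI; have: #|I| - k.-1 <= k * r by lia.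
  move=> le_I le_G; rewrite -(leq_pmul2r k_gt0) (leq_trans le_G) //.
  by rewrite [r * _]mulnC -mulnA [r * k]mulnC leq_mul2l le_I orbT.
have [|lt_bn] := leqP n b.
  move=> le_nb; apply: IHb k_gt0 _ Gsh Gr => A /GP[cA Aab]; split=> // x /Aab.
  by case/andP=> -> _; rewrite (leq_trans _ le_nb).
pose x := Ordinal lt_bn.
case: k k_gt0 GP GI large => [//|[_ GP GI _|k _ GP GI large]].
  have le_Gr : #|G| <= r.
    rewrite leqNgt; apply/negP => lt_rG; apply: Gr.
    apply: (@has_matching_in _ _ _ _ (mem G) id) => // A B AG BG.
    have [[/eqP/cards1P[u ->] _] [/eqP/cards1P[v ->] _]] := (GP A AG, GP B BG).
    by move=> neq; rewrite disjoints1 inE; apply: contra neq => /eqP->.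
  have [->|[A AG]] := set_0Vmem G; first by rewrite cards0.
  apply: leq_trans le_Gr _; rewrite leq_pmulr //; apply/card_gt0P.
  have [/eqP/cards1P[u uE] _] := GP A AG.
  by exists set0; apply/shadowP; exists u; rewrite ?inE // setU0 -uE.
pose G0 := [set A in G | x \notin A].
pose G1 := [set B : {set 'I_n} | (x \notin B) && (x |: B \in G)].
have cG : #|G| = #|G0| + #|G1|.
  rewrite -(cardsID [set A : {set 'I_n} | x \in A] G) addnC; congr (_ + _).
    by apply: eq_card => A; rewrite !inE andbC.
  rewrite -[RHS](@card_in_imset _ _ (fun B => x |: B)).
    apply: eq_card => A; rewrite !inE; apply/andP/imsetP => [[AG xA]|[B]].
      by exists (A :\ x); rewrite ?inE ?eqxx setD1K.
    by rewrite inE => /andP[xB xBG] ->; rewrite xBG setU11.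
  move=> B C; rewrite !inE => /andP[xB _] /andP[xC _] /(congr1 (fun A => A :\ x)).
  by rewrite !setU1K.
have lt_x A (y : 'I_n) : A \in G -> y \in A -> y != x -> y < b.
  move=> /GP[_ Aab] /Aab /andP[_]; rewrite ltnS leq_eqVlt -val_eqE /=.
  by case: eqP.
have le0 : #|G0| <= r * #|shadow G0|.
  apply: (IHb k.+2) => //.
  - move=> A; rewrite inE => /andP[AG xA]; have [cA Aab] := GP A AG.
    split=> // y yA; have /andP[-> _] /= := Aab y yA.
    by apply: (lt_x A) => //; apply: contraNneq xA => <-.
  - move=> i j A le_ai lt_ij; rewrite !inE => /andP[AG xA] jA iA.
    rewrite Gsh //= (negPf xA) andbF orbF.
    have /andP[_] := (GP A AG).2 j jA; rewrite -val_eqE /=; lia.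
  move=> HM; apply: Gr; apply: has_matchingS HM.
  by apply/subsetP => A; rewrite inE => /andP[].
have le1 : #|G1| <= r * #|shadow G1|.
  apply: (IHb k.+1) => //.
  - move=> A; rewrite inE => /andP[xA AG]; have [cA Aab] := GP _ AG.
    move: cA; rewrite cardsU1 xA => -[cA]; split=> // y yA.
    have yxA : y \in x |: A by rewrite inE yA orbT.
    have /andP[-> _] /= := Aab y yxA.
    by apply: lt_x AG yxA _; apply: contraNneq xA => <-.
  - move=> i j A le_ai lt_ij; rewrite !inE => /andP[xA AG] jA iA.
    have jx : j != x by apply: contraNneq xA => <-.
    have lt_jb : j < b by apply: lt_x AG _ jx; rewrite inE jA orbT.
    have ix : i != x by rewrite -val_eqE /=; lia.
    rewrite negb_or eq_sym ix (negPf xA) andbF /= setUCA.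
    have -> : x |: A :\ j = (x |: A) :\ j.
      by apply/setP => y; rewrite !inE; case: eqP => // ->; rewrite eq_sym (negPf jx).
    by apply: Gsh => //; rewrite !inE ?jA ?orbT // negb_or ix.
  move=> [M MG MD]; apply: Gr.
  pose U := \bigcup_i M i.
  have cU : #|U| <= r.+1 * k.+1.
    rewrite -[X in X * _](card_ord r.+1) -sum_nat_const.
    apply: (big_ind2 (fun (B : {set 'I_n}) c => #|B| <= c)) => [|B c C d le1 le2|i _].
    - by rewrite cards0.
    - by apply: leq_trans (leq_card_setU _ _) _; apply: leq_add.
    have := MG i; rewrite inE => /andP[xM /GP[]].
    by rewrite cardsU1 xM add1n => -[->].
  have le_IU : r.+1 <= #|I :\: U|.
    rewrite cardsD; have : #|I :&: U| <= #|U| by apply: subset_leq_card; apply: subsetIr.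
    move: large cU; rewrite mulSn [r.+1 * _]mulnC; lia.
  pose y (i : 'I_r.+1) := enum_val (widen_ord le_IU i).
  have yP i : y i \in I :\: U by apply: enum_valP.
  have yU i j : y i \notin M j.
    have := yP i; rewrite inE => /andP[+ _]; apply: contra => yM.
    by apply/bigcupP; exists j.
  exists (fun i => y i |: M i) => [i|i j neq_ij].
    have := MG i; rewrite inE => /andP[xM xMG].
    have [->//|neq_yx] := eqVneq (y i) x.
    have := yP i; rewrite !inE => /and3P[_ le_ay lt_yb].
    rewrite -(setU1K xM); apply: Gsh => //; rewrite ?setU11 //.
      by move: neq_yx; rewrite -val_eqE /=; lia.
    by rewrite !inE negb_or neq_yx yU.
  rewrite disjoints_subset subUset sub1set !inE negb_or yU.
  rewrite -disjoints_subset disjoint_sym disjoints_subset subUset sub1set inE yU /=.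
  rewrite -disjoints_subset disjoint_sym MD // !andbT.
  by apply: contraNneq neq_ij => /enum_val_inj /(congr1 val) /= /val_inj->.
have disj_sh : [disjoint shadow G0 & [set x |: C | C in shadow G1]].
  rewrite disjoint_sym disjoints_subset; apply/subsetP => _ /imsetP[C _ ->].
  rewrite inE; apply/shadowP => -[z _]; rewrite !inE => /andP[_].
  by rewrite eqxx !orbT.
have sub_sh : shadow G0 :|: [set x |: C | C in shadow G1] \subset shadow G.
  rewrite subUset; apply/andP; split; apply/subsetP => B.
    by case/shadowP=> z zB; rewrite inE => /andP[zBG _]; apply/shadowP; exists z.
  case/imsetP=> C /shadowP[z zC]; rewrite inE => /andP[+ zCG] ->.
  rewrite in_setU1 negb_or => /andP[xz xC].
  apply/shadowP; exists z; last by rewrite setUCA.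
  by rewrite !inE negb_or eq_sym xz.
have cI : #|[set x |: C | C in shadow G1]| = #|shadow G1|.
  apply: card_in_imset => B C.
  case/shadowP=> z _; rewrite inE in_setU1 negb_or => /andP[/andP[_ xB] _].
  case/shadowP=> u _; rewrite inE in_setU1 negb_or => /andP[/andP[_ xC] _].
  by move=> /(congr1 (fun A => A :\ x)); rewrite !setU1K.
have := subset_leq_card sub_sh; rewrite cardsU cI.
move: disj_sh; rewrite -setI_eq0 => /eqP->; rewrite cards0 subn0 => le_sh.
by rewrite cG (leq_trans (leq_add le0 le1)) // -mulnDr leq_mul2l le_sh orbT.
Qed.

End Shadow.

(** * Stability in the Erdos matching problem *)

(** Hall's condition in its greedy form: the sets can be served in this order. *)
Lemma greedy_choice (J : finType) l (c : nat -> {set J}) :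
  (forall k, k < l -> k < #|c k|) ->
  exists u : seq J,
    [/\ uniq u, size u = l & forall x0 k, k < l -> nth x0 u k \in c k].
Proof.
elim: l => [|l IHl] cP; first by exists [::].
have [k lt_kl|u [uu su uc]] := IHl; first by apply: cP; apply: leqW.
have [y yc yu] : exists2 y, y \in c l & y \notin u.
  apply/subsetPn; apply: contraL (cP l (leqnn _)) => /subset_leq_card le_c.
  by rewrite -leqNgt (leq_trans le_c) // -su card_size.
exists (rcons u y); split; first by rewrite rcons_uniq yu uu.
  by rewrite size_rcons su.
move=> x0 k; rewrite nth_rcons su ltnS leq_eqVlt => /predU1P[->|lt_kl].
  by rewrite ltnn eqxx.
by rewrite lt_kl; apply: uc.
Qed.

(** Here b counts the blocks in each of l nested rows.  If row l - 1 - k has at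
    most k of the t blocks, then the k rows before the last one each lack t - k
    blocks, while the last row has at most k; this trades k(t - k) absences
    against k presences. *)
Lemma nested_profile_bound l t (b : nat -> nat) k : k < l ->
  (forall r r', r <= r' -> r' < l -> b r' <= b r) -> b (l.-1 - k) <= k ->
  (t - l.-1) * b l.-1 <= \sum_(0 <= r < l.-1) (t - b r).
Proof.
move=> lt_kl bmono le_bk.
have le_top : b l.-1 <= k by apply: leq_trans le_bk; apply: bmono; lia.
rewrite (@big_cat_nat _ _ _ (l.-1 - k)) ?leq_subr //=.
apply: leq_trans (leq_addl _ _).
apply: (@leq_trans ((t - k) * k)); first by apply: leq_mul => //; lia.
rewrite mulnC -[X in X * _](_ : l.-1 - (l.-1 - k) = k); last by lia.
rewrite -sum_nat_const_nat big_nat_cond [X in _ <= X]big_nat_cond.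
apply: leq_sum => r /andP[/andP[le_r lt_r] _].
by apply: leq_sub2l; apply: leq_trans le_bk; apply: bmono; lia.
Qed.

Section Stability.
Variables n m l : nat.
Variable F : {set {set 'I_n}}.
Hypotheses (m_gt1 : 1 < m) (l_gt0 : 0 < l) (le_mln : 2 * m * l <= n).
Hypothesis Fsh : shifted F.
Hypothesis Fl : ~ has_matching [set A in F | #|A| == m] l.

Let Y := [set i : 'I_n | l <= i].
Let L := [set i : 'I_n | i < l.-1].
(* Rows are the points below l, the last row being [top]; [link r] is seen on Y. *)
Let link (r : 'I_n) := [set E : {set 'I_n} | r |: E \in F].

Lemma lt_top : l.-1 < n.
Proof. nia. Qed.
Let top := Ordinal lt_top.

Lemma card_Y : #|Y| = n - l.
Proof.
rewrite cardsCs card_ord -[in RHS](@card_initial n l); last by nia.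
by congr (_ - _); apply: eq_card => i; rewrite !inE -ltnNge.
Qed.

Lemma link_mono (r r' : 'I_n) (E : {set 'I_n}) : E \subset Y -> r <= r' -> r' < l ->
  E \in link r' -> E \in link r.
Proof.
move=> sEY; rewrite leq_eqVlt => /predU1P[/val_inj-> //|lt_r lt_r'l].
have YE (x : 'I_n) : x < l -> x \notin E.
  by move=> lt_x; apply/negP => /(subsetP sEY); rewrite inE; lia.
rewrite !inE => r'EF; rewrite -(setU1K (YE _ lt_r'l)).
apply: Fsh => //; first by rewrite setU11.
by rewrite !inE negb_or YE ?(ltn_trans lt_r) // andbT neq_ltn lt_r.
Qed.

(* As many disjoint blocks of size m - 1 as fit in Y. *)
Let t := (n - l) %/ m.-1.

(** Otherwise the rows, taken from the last one backwards, can be given distinct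
    blocks, and the sets consisting of a row and its block are l disjoint m-sets
    of F. *)
Lemma no_row_matching (e : 'I_t -> {set 'I_n}) :
  (forall j, e j \subset Y /\ #|e j| = m.-1) -> disjoint_family e ->
  exists2 k, k < l &
    forall r : 'I_n, val r = l.-1 - k -> #|[set j | e j \in link r]| <= k.
Proof.
move=> eP eD;
pose c k := [set j : 'I_t | [exists r : 'I_n, (val r == l.-1 - k) && (e j \in link r)]].
have [/existsP[k le_ck]|] := boolP [exists k : 'I_l, #|c k| <= k].
  exists k => // r rE; apply: leq_trans le_ck; apply/subset_leq_card/subsetP => j.
  by rewrite !inE => jr; apply/existsP; exists r; rewrite rE eqxx inE.
move/existsPn=> cP; have [k lt_kl|u [uu su uc]] := @greedy_choice _ l c.
  by rewrite ltnNge; apply: cP (Ordinal lt_kl).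
case: Fl.
have t_gt0 : 0 < t by rewrite divn_gt0; nia.
pose j0 := Ordinal t_gt0.
pose J (k : 'I_l) := nth j0 u k.
have lt_row (k : 'I_l) : l.-1 - k < n by have := lt_top; lia.
pose R k := Ordinal (lt_row k).
have Re (k k' : 'I_l) : R k \notin e (J k').
  apply/negP => /(subsetP (eP _).1); rewrite inE /=; lia.
exists (fun k => R k |: e (J k)) => [k|k k' neq_k].
  rewrite inE cardsU1 Re (eP _).2 add1n prednK ?(ltnW m_gt1) // eqxx andbT.
  have := uc j0 k (ltn_ord k); rewrite inE => /existsP[r /andP[/eqP rE]].
  by rewrite inE; congr (_ |: _ \in F); apply: val_inj.
have neq_J : J k != J k'.
  by rewrite /J nth_uniq ?su // -val_eqE in neq_k *.
rewrite disjoints_subset subUset sub1set !inE negb_or Re.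
rewrite -disjoints_subset disjoint_sym disjoints_subset subUset sub1set inE Re /=.
rewrite -disjoints_subset disjoint_sym eD // !andbT -val_eqE /=.
by move: neq_k; rewrite -val_eqE /=; move: (ltn_ord k) (ltn_ord k'); lia.
Qed.

Let deficit r := #|slice (~: link r) Y m.-1|.
Let top_size := #|slice (link top) Y m.-1|.

(** Frankl's inequality: average [nested_profile_bound] over all placements of t
    disjoint blocks of size m - 1 in Y. *)
Lemma row_trade : (t - l.-1) * top_size <= \sum_(r in L) deficit r.
Proof.
have m1_gt0 : 0 < m.-1 by lia.
have t_gt0 : 0 < t by rewrite divn_gt0 //; nia.
have [|e eP eD] := @blocks_exist _ 'I_t (fun=> m.-1) Y.
  by rewrite sum_nat_const card_ord card_Y leq_divM.
pose w := t - l.-1.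
pose J := ('I_n * 'I_t)%type.
pose H (j : J) := if j.1 == top then link top else ~: link j.1.
pose c (j : J) : rat := if j.1 == top then (- w%:R)%R else (j.1 \in L)%:R%R.
have L_top : top \notin L by rewrite inE /= ltnn.
have C_gt0 : 0 < 'C(#|Y|, m.-1).
  by rewrite bin_gt0 -(eP (Ordinal t_gt0)).2 subset_leq_card ?(eP _).1.
have split_sum (v : J -> rat) : (\sum_j c j * v j =
    \sum_(r in L) \sum_(j < t) v (r, j) - w%:R * \sum_(j < t) v (top, j))%R.
  have -> : (\sum_j c j * v j = \sum_r \sum_j c (r, j) * v (r, j))%R.
    by rewrite pair_bigA; apply: eq_bigr => -[].
  rewrite (bigD1 top) //= addrC.
  congr (_ + _)%R; last first.
    by rewrite mulr_sumr -sumrN; apply: eq_bigr => j _; rewrite /c eqxx mulNr.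
  rewrite [RHS]big_mkcond [in RHS](bigD1 top) //= (negPf L_top) add0r.
  apply: eq_bigr => r rtop; case: ifP => rL.
    by apply: eq_bigr => j _; rewrite /c /= (negPf rtop) rL mul1r.
  by apply: big1 => j _; rewrite /c /= (negPf rtop) rL mul0r.
have : (0 <= \sum_j c j * density (H j) Y m.-1)%R.
  apply: (@averaging _ J c 0%R Y (fun=> m.-1) (fun j => e j.2) H) => [j|p pY].
    exact: eP.
  rewrite (split_sum (fun j => (p @: e j.2 \in H j)%:R)%R) /= /H /=.
  have peP j : p @: e j \subset Y /\ #|p @: e j| = m.-1.
    split; last by rewrite card_imset ?(eP _).2 //; apply: perm_inj.
    apply/subsetP => _ /imsetP[u ue ->]; rewrite perm_closed //.
    by apply: (subsetP (eP j).1).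
  have peD : disjoint_family (fun j => p @: e j).
    by move=> i j neq; rewrite imset_disjoint; [apply: eD | apply: perm_inj].
  have [k lt_kl kP] := no_row_matching peP peD.
  pose b r := #|[set j | [exists r' : 'I_n, (val r' == r) && (p @: e j \in link r')]]|.
  have bE (r : 'I_n) : b r = #|[set j | p @: e j \in link r]|.
    apply: eq_card => j; rewrite !inE; apply/existsP/idP => [[r' /andP[/eqP/val_inj->]]|jr].
      by rewrite inE.
    by exists r; rewrite eqxx inE.
  have lt_n r : r < l -> r < n by have := lt_top; lia.
  have := @nested_profile_bound l t b k lt_kl.
  have b_mono r r' : r <= r' -> r' < l -> b r' <= b r.
    move=> le_r lt_r'; have lt_r := leq_ltn_trans le_r lt_r'.
    rewrite (bE (Ordinal (lt_n _ lt_r))) (bE (Ordinal (lt_n _ lt_r'))).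
    apply/subset_leq_card/subsetP => j; rewrite inE [in X in _ -> X]inE.
    by apply: link_mono => //; apply: (peP j).1.
  have lt_k : l.-1 - k < l by lia.
  move/(_ b_mono); rewrite (bE (Ordinal (lt_n _ lt_k))) => /(_ (kP (Ordinal (lt_n _ lt_k)) erefl)).
  rewrite (bE top) eqxx -natr_sum subr_ge0 => le_b.
  have -> : \sum_(j < t) (p @: e j \in link top : nat) = #|[set j | p @: e j \in link top]|.
    by rewrite -sum1dep_card [RHS]big_mkcond; apply: eq_bigr => j _; case: (_ \in _).
  have -> : (\sum_(r in L) \sum_(j < t)
      (p @: e j \in (if r == top then link top else ~: link r))%:R =
     (\sum_(0 <= r < l.-1) (t - b r))%:R :> rat)%R.
    rewrite natr_sum big_mkord.
    rewrite (big_ord_widen _ (fun r => (t - b r)%:R : rat)%R (ltnW lt_top)).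
    apply: eq_big => r; first by rewrite inE.
    rewrite inE => lt_r; have /negPf-> : r != top by rewrite -val_eqE /=; lia.
    rewrite -natr_sum; congr (_%:R)%R.
    have -> : t - b r = #|~: [set j | p @: e j \in link r]|.
      by rewrite bE [RHS]cardsCs setCK card_ord.
    rewrite -sum1_card [RHS]big_mkcond.
    by apply: eq_bigr => j _; rewrite !inE; case: (_ \in _).
  by rewrite -natrM ler_nat.
rewrite split_sum.
have dE (B : {set {set 'I_n}}) :
    (\sum_(j < t) density B Y m.-1 = (t%:R / 'C(#|Y|, m.-1)%:R) * #|slice B Y m.-1|%:R)%R.
  by rewrite sumr_const card_ord -[LHS]mulr_natl /density mulrA mulrAC.
rewrite /H /= eqxx dE.
under eq_bigr => r rL.
  have /negPf-> : r != top by apply: contraNneq L_top => <-.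
  rewrite dE; over.
rewrite -mulr_sumr mulrCA -mulrBr pmulr_rge0 ?divr_gt0 ?ltr0n //.
by rewrite subr_ge0 -natrM -natr_sum ler_nat.
Qed.

Lemma deficits_le_missing_star : \sum_(r in L) deficit r <= #|missing_star F L m|.
Proof.
have dLY : [disjoint L & Y].
  by rewrite disjoints_subset; apply/subsetP => i; rewrite !inE; lia.
apply: leq_trans (leq_trans (star_slices_le (~: F) m.-1 dLY) _).
  apply: leq_sum => r _; apply/subset_leq_card/subsetP => E.
  by rewrite !inE.
apply/subset_leq_card/subsetP => A; rewrite !inE prednK //; exact: ltnW.
Qed.

(** The m-sets avoiding L either contain [top], and are counted by its link, or lie
    in Y.  By shifting, the shadow of the latter lies in the link of [top], so
    [shadow_card_ge] applies. *)
Lemma light_layer_le : #|[set A in F | (#|A| == m) && (A \subset ~: L)]| <= l * top_size.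
Proof.
have topL : top \in ~: L by rewrite !inE -leqNgt /=.
have sYL : Y \subset ~: L by apply/subsetP => i; rewrite !inE; lia.
have topY : top \notin Y by rewrite inE /=; lia.
have YE (i : 'I_n) : i \in ~: L -> i != top -> i \in Y.
  by rewrite !inE -val_eqE /=; lia.
pose G := [set A in F | (#|A| == m) && (A \subset Y)].
have topE (A : {set 'I_n}) : A \subset ~: L -> top \notin A -> A \subset Y.
  move=> sAL topA; apply/subsetP => i iA; apply: YE; first exact: (subsetP sAL).
  by apply: contraNneq topA => <-.
have cG : #|[set A in F | (#|A| == m) && (A \subset ~: L)]| <= top_size + #|G|.
  rewrite -(cardsID [set A : {set 'I_n} | top \in A]); apply: leq_add; last first.
    apply/subset_leq_card/subsetP => A; rewrite !inE => /andP[tA /and3P[-> -> sAL]] /=.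
    exact: topE.
  rewrite -(@card_in_imset _ _ (fun A => A :\ top)); last first.
    move=> A B; rewrite !inE => /andP[_ xA] /andP[_ xB] /(congr1 (setU [set top])).
    by rewrite !setD1K.
  apply/subset_leq_card/subsetP => _ /imsetP[A + ->].
  rewrite !inE => /andP[/and3P[AF /eqP cA sAL] tA].
  rewrite setD1K // AF topE ?setD11 //=; last first.
    by apply: subset_trans sAL; apply: subD1set.
  by have := cardsD1 top A; rewrite tA cA add1n => ->.
apply: leq_trans cG _; rewrite -[in X in _ <= X](prednK l_gt0) mulSn leq_add2l.
have sub : #|shadow G| <= top_size.
  apply/subset_leq_card/subsetP => B /shadowP[x xB]; rewrite inE.
  case/and3P=> xBF; rewrite cardsU1 xB add1n => /eqP cB sub.
  have sBY : B \subset Y by apply: subset_trans sub; apply: subsetUr.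
  have xY : x \in Y by apply: (subsetP sub); apply: setU11.
  have topB : top \notin B by apply: contra topY; apply/subsetP.
  rewrite 2!inE sBY -cB /= eqxx !andbT -(setU1K xB).
  apply: Fsh => //; rewrite ?setU11 //; first by move: xY; rewrite inE /=; lia.
  by rewrite !inE negb_or topB andbT; apply: contraNneq topY => ->.
apply: leq_trans (_ : l.-1 * #|shadow G| <= _); last by rewrite leq_mul2l sub orbT.
apply: (@shadow_card_ge n m l.-1 G l n); first by lia.
- move=> A; rewrite inE => /and3P[_ /eqP-> /subsetP sAY]; split=> // x /sAY.
  by rewrite inE => ->; rewrite ltn_ord.
- move=> i j A le_li lt_ij; rewrite !inE => /and3P[AF /eqP cA sAY] jA iA.
  rewrite Fsh //= subUset sub1set inE le_li /= (subset_trans (subD1set _ _) sAY) andbT.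
  by have := cardsD1 j A; rewrite jA cardsU1 !inE (negPf iA) andbF cA => <-.
rewrite prednK // => HM; apply: Fl; apply: has_matchingS HM.
by apply/subsetP => A; rewrite !inE => /and3P[-> ->].
Qed.

(** The gain from m-sets avoiding L is at most l [top_size], while [row_trade] makes
    the loss among the m-sets with one point in L at least t - l + 1 times
    [top_size].  As n is at least 2ml, (m-1)(t-l+1) is at least ml, and a
    fraction 1/m of the loss remains. *)
Lemma missing_layer_stability :
  m * 'C(n - l.-1, m) + #|missing_star F L m| <=
  m * #|missing F m|.
Proof.
have cL : #|~: L| = n - l.-1.
  rewrite cardsCs setCK card_ord (@card_initial n l.-1) //.
  by have := lt_top; lia.
have := cards_draws (~: L) m; rewrite cL => cC.
have low := light_layer_le.
have c0 : 'C(n - l.-1, m) <= #|[set A in F | (#|A| == m) && (A \subset ~: L)]| +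
    #|[set A : {set 'I_n} | [&& A \notin F, #|A| == m & A \subset ~: L]]|.
  pose D := [set A : {set 'I_n} | A \subset ~: L & #|A| == m].
  rewrite -cC -(cardsID F D); apply: leq_add; apply/subset_leq_card/subsetP => A.
    by rewrite !inE => /andP[/andP[-> ->] ->].
  by rewrite !inE => /andP[-> /andP[-> ->]].
have cM : #|missing_star F L m| +
    #|[set A : {set 'I_n} | [&& A \notin F, #|A| == m & A \subset ~: L]]| <=
    #|missing F m|.
  apply: card_disjoint_le.
  - by apply/subsetP => A; rewrite !inE => /and3P[-> ->].
  - by apply/subsetP => A; rewrite !inE => /and3P[-> ->].
  apply/setP => A; rewrite !inE; apply/negbTE.
  apply/negP => /andP[/and3P[_ _ /eqP c1] /and3P[_ _]].
  by rewrite -disjoints_subset -setI_eq0 -cards_eq0 c1.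
have trade := leq_trans row_trade deficits_le_missing_star.
have : m * l * top_size <= m.-1 * #|missing_star F L m|.
  apply: leq_trans (_ : m.-1 * ((t - l.-1) * top_size) <= _).
    rewrite mulnA leq_mul2r; apply/orP; right.
    have := ltn_pmod (n - l) (_ : 0 < m.-1); have := divn_eq (n - l) m.-1.
    rewrite -/t => tE /(_ ltac:(lia)) lt_mod.
    have le_tl : m * l <= m.-1 * t - m.-1 * l.-1; last by rewrite mulnBr.
    by nia.
  by rewrite leq_mul2l trade orbT.
by nia.
Qed.

End Stability.

(** * Missing sets forced by a matching in layer m *)

Section Surplus.
Variables (T : finType) (F : {set {set T}}) (m s l : nat).
Hypothesis card_T : #|T| + l = m.+1 * s.
Hypothesis Fs : ~ has_matching F s.

(** The complement of the matching splits exactly into s - l - mK blocks of size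
    m + 1, that is K blocks more than what a matching of size s requires.  Hence
    every such partition has more than K missing blocks; average over them. *)
Lemma missing_ge_of_matching K : l + m * K < s ->
  has_matching [set A in F | #|A| == m] (l + m.+1 * K) ->
  K.+1 * 'C(m.+1 * (s - l - m * K) - 1, m) <= #|missing F m.+1|.
Proof.
move=> lt_s [M MF MD]; pose q := s - l - m * K.
have q_gt0 : 0 < q by rewrite /q; lia.
pose U := \bigcup_i M i.
have cU : #|U| = (l + m.+1 * K) * m.
  rewrite -sum1_card partition_disjoint_bigcup //=.
  under eq_bigr => i _.
    rewrite sum1_card; have := MF i; rewrite inE => /andP[_ /eqP->]; over.
  by rewrite sum_nat_const card_ord.
pose Z := ~: U.
have cZ : #|Z| = m.+1 * q.
  by rewrite cardsCs setCK cU /q; nia.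
have [|e eP eD] := @blocks_exist _ 'I_q (fun=> m.+1) Z.
  by rewrite sum_nat_const card_ord cZ mulnC.
have : (K.+1%:R <= \sum_(j < q) 1 * density (~: F) Z m.+1 :> rat)%R.
  apply: (@averaging _ _ _ _ Z (fun=> m.+1) e (fun=> ~: F)) => [j|p pZ]; first exact: eP.
  under eq_bigr => j _ do rewrite mul1r.
  rewrite -natr_sum ler_nat.
  pose good := [set j | p @: e j \in F].
  have -> : \sum_(j < q) (p @: e j \in ~: F : nat) = #|~: good|.
    by rewrite -sum1_card [RHS]big_mkcond; apply: eq_bigr => j _; rewrite !inE; case: (_ \in _).
  rewrite cardsCs setCK card_ord ltnNge; apply/negP => le_bad; apply: Fs.
  have peZ j : p @: e j \subset Z by apply: perm_on_imset (eP j).1.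
  pose V (i : 'I_(l + m.+1 * K) + 'I_q) :=
    match i with inl i => M i | inr j => p @: e j end.
  pose D (i : 'I_(l + m.+1 * K) + 'I_q) := match i with inl _ => true | inr j => j \in good end.
  have cD : #|D| = l + m.+1 * K + #|good|.
    rewrite card_sum_pred -[in RHS](card_ord (l + m.+1 * K)) -cardsT.
    congr (_ + _); apply: eq_card => i; rewrite !inE //.
    by rewrite -topredE /= inE.
  apply: (@has_matching_in _ _ _ _ D V).
  - by rewrite cD /q in le_bad *; lia.
  - move=> [i|j] /=; first by have := MF i; rewrite inE => /andP[].
    by rewrite -topredE /= inE.
  have pD := disjoint_family_perm p eD.
  have dMZ i j : [disjoint M i & p @: e j].
    rewrite disjoint_sym disjoints_subset (subset_trans (peZ j)) // setCS.
    exact: (bigcup_sup i).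
  move=> [i|j] [i'|j'] _ _ /= neq.
  - by apply: MD; apply: contra neq => /eqP->.
  - exact: dMZ.
  - by rewrite disjoint_sym; apply: dMZ.
  - by apply: pD; apply: contra neq => /eqP->.
rewrite sumr_const card_ord mul1r -[X in (_ <= X)%R]mulr_natl /density mulrA.
have cC : 'C(#|Z|, m.+1) = q * 'C(m.+1 * q - 1, m).
  have := mul_bin_diag (m.+1 * q) m; rewrite -cZ -subn1.
  by move/eqP; rewrite {1}cZ -mulnA eqn_pmul2l // => /eqP <-; rewrite cZ.
have C_gt0 : 0 < 'C(#|Z|, m.+1) by rewrite bin_gt0 cZ leq_pmulr.
rewrite ler_pdivlMr ?ltr0n // -!natrM ler_nat cC mulnCA leq_pmul2l // => le_K.
apply: leq_trans le_K _; apply/subset_leq_card/subsetP => A.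
by rewrite !inE => /and3P[-> _ ->].
Qed.

End Surplus.

(** * Missing sets forced by light sets *)

Section LightSets.
Variables (T : finType) (L : {set T}) (m r : nat) (A : 'I_r -> {set T}).
Hypotheses (AD : disjoint_family A) (Aw : forall a, #|A a| + #|A a :&: L| <= m).

Let U := \bigcup_a A a.
Let L' := L :\: U.
Let Z := ~: (L :|: U).

Lemma card_U_le : #|U| + #|L| <= r * m + #|L'|.
Proof.
have cU : #|U| = \sum_a #|A a|.
  rewrite -sum1_card partition_disjoint_bigcup //=.
  by apply: eq_bigr => a _; rewrite sum1_card.
have cUL : #|L :&: U| = \sum_a #|A a :&: L|.
  have -> : L :&: U = \bigcup_a (A a :&: L).
    by rewrite setIC /U big_distrl.
  rewrite -sum1_card partition_disjoint_bigcup /=.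
    by apply: eq_bigr => a _; rewrite sum1_card.
  move=> a b neq_ab; apply: disjointWl (subsetIl _ _) _.
  by apply: disjointWr (subsetIl _ _) _; apply: AD.
rewrite -(cardsID U L) cU cUL addnA leq_add2r -big_split /=.
apply: (@leq_trans (\sum_(a < r) m)); first by apply: leq_sum => a _; apply: Aw.
by rewrite sum_nat_const card_ord.
Qed.

Lemma card_Z_ge : #|T| <= #|Z| + #|L| + r * m.
Proof.
have := card_U_le; have := subset_leq_card (subsetDl L U).
have := cardsC (L :|: U); have := leq_card_setU L U => -[+ _].
by rewrite -/L' -/Z; lia.
Qed.

Variables (F : {set {set T}}) (s k : nat).
Hypotheses (m_gt0 : 0 < m) (le_rLs : r + #|L| <= s).
(* The ground set has weight |T| + |L|; placing r sets of weight m instead of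
   m + 1 leaves room for k spare points. *)
Hypothesis le_weights : m.+1 * s + k <= #|T| + #|L| + r.
Hypotheses (Fs : ~ has_matching F s) (AF : forall a, A a \in F).

Let q := s - r - #|L'|.
Let J := (T + 'I_q + 'I_k)%type.

(* A block of size m - 1 for each remaining point of L, q blocks of size m + 1, and
   k spare points; rows outside L' get the empty block. *)
Let block_size (j : J) := match j with
  | inl (inl i) => if i \in L' then m.-1 else 0
  | inl (inr _) => m.+1
  | inr _ => 1 end.

Lemma blocks_fit : \sum_j block_size j <= #|Z|.
Proof.
have cZ : #|Z| + #|L'| + #|U| = #|T|.
  have := cardsC (L :|: U); have := subset_leq_card (subsetIl L U).
  by rewrite -/Z /L' cardsD cardsU; lia.
rewrite !big_sumType /= -big_mkcond /= !sum_nat_const !card_ord.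
rewrite -[#|_|]/#|L'|.
have := card_U_le; have := subset_leq_card (subsetDl L U).
rewrite -/L' /q; nia.
Qed.

Section Placed.
Variable e : J -> {set T}.
Hypotheses (eZ : forall j, e j \subset Z) (eD : disjoint_family e).
Let row i := e (inl (inl i)).
Let part j := e (inl (inr j)).
Let spare k := e (inr k).
Let bad := [set i in L' | i |: row i \notin F].

(** With at most k bad rows, one spare point is added to each of them.  The sets A,
    the rows (repaired where necessary) and the blocks of size m + 1 would then be s
    disjoint members of F. *)
Lemma bad_rows_gt : (forall j, part j \in F) ->
  (forall i h, i \in L' -> i |: (row i :|: spare h) \in F) -> k < #|bad|.
Proof.
move=> partF spareF; rewrite ltnNge; apply/negP => le_bad; apply: Fs.
(* The bad rows receive the spare points in the order of their enumeration. *)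
pose owned i h := (i \in bad) && (index i (enum bad) == h :> nat).
pose W i := \bigcup_(h < k | owned i h) spare h.
pose I := ('I_r + T + 'I_q)%type.
pose V (x : I) := match x with
  | inl (inl a) => A a
  | inl (inr i) => if i \in L' then i |: (row i :|: W i) else set0
  | inr j => part j end.
(* Each block of e is used by at most one of the sets V; this gives disjointness. *)
pose owns (x : I) (y : J) := match x, y with
  | inl (inr i), inl (inl i') => i == i'
  | inr j, inl (inr j') => j == j'
  | inl (inr i), inr h => owned i h
  | _, _ => false end.
have owns_inj x x' y : owns x y -> owns x' y -> x = x'.
  case: x x' y => [[a|i]|j] [[a'|i']|j'] [[y|y]|y] //=.
  - by move=> /eqP-> /eqP->.
  - case/andP=> ib /eqP iy /andP[i'b /eqP i'y]; congr (inl (inr _)).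
    have nthE h : h \in bad -> nth i (enum bad) (index h (enum bad)) = h.
      by move=> hb; rewrite nth_index ?mem_enum.
    by rewrite -(nthE i ib) iy -i'y nthE.
  - by move=> /eqP-> /eqP->.
have memV x z : z \in V x ->
    [\/ exists2 a, x = inl (inl a) & z \in A a,
        z \in L' /\ x = inl (inr z) | exists2 y, owns x y & z \in e y].
  case: x => [[a|i]|j] /=.
  - by move=> zA; apply: Or31; exists a.
  - case: ifP => [iL'|_]; last by rewrite inE.
    rewrite in_setU1 in_setU => /or3P[/eqP->|zr|/bigcupP[h oh zh]]; first by apply: Or32; split.
      by apply: Or33; exists (inl (inl i)) => //=.
    by apply: Or33; exists (inr h).
  by move=> zj; apply: Or33; exists (inl (inr j)) => //=.
have notU z : z \in L' -> z \notin U by rewrite inE => /andP[].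
have ZU y z : z \in e y -> z \notin U.
  by move/(subsetP (eZ y)); rewrite !inE negb_or => /andP[].
have ZL y z : z \in e y -> z \notin L'.
  by move/(subsetP (eZ y)); rewrite !inE negb_or => /andP[/negPf-> _]; rewrite andbF.
have AU a z : z \in A a -> z \in U by move=> zA; apply/bigcupP; exists a.
have VD : disjoint_family V.
  apply: disjoint_familyP => x x' z /memV[[a -> za]|[zL ->]|[y xy zy]]
      /memV[[a' -> za']|[zL' ->]|[y' xy' zy']] //.
  - by rewrite (disjoint_family_eq AD za za').
  - by have := notU z zL'; rewrite (AU _ _ za).
  - by have := ZU _ _ zy'; rewrite (AU _ _ za).
  - by have := notU z zL; rewrite (AU _ _ za').
  - by have := ZL _ _ zy'; rewrite zL.
  - by have := ZU _ _ zy; rewrite (AU _ _ za').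
  - by have := ZL _ _ zy; rewrite zL'.
  by have eq_y := disjoint_family_eq eD zy zy'; rewrite eq_y in xy; apply: owns_inj xy'.
pose D (x : I) := if x is inl (inr i) then i \in L' else true.
apply: (@has_matching_in _ _ _ _ D V).
- rewrite card_sum_pred.
  have -> : #|[set x | inl x \in D]| = r + #|L'|.
    rewrite cardsE card_sum_pred -[in RHS](card_ord r) -cardsT.
    by congr (_ + _); apply: eq_card => x; rewrite [LHS]inE [LHS]inE -topredE /= ?inE.
  have -> : #|[set j | inr j \in D]| = q.
    by rewrite -[RHS]card_ord -cardsT; apply: eq_card => x; rewrite !inE -topredE.
  have := subset_leq_card (subsetDl L U); rewrite -/L' /q; lia.
- case=> [[a|i]|j] /= xD; [exact: AF| |exact: partF].
  have iL' : i \in L' by [].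
  rewrite iL'; have [ib|ib] := boolP (i \in bad); last first.
    rewrite (_ : W i = set0) ?setU0; last by apply: big_pred0 => h; rewrite /owned (negPf ib).
    by move: ib; rewrite inE iL' negbK.
  have lt_i : index i (enum bad) < k.
    rewrite (@leq_trans #|bad|) //.
    by rewrite cardE index_mem mem_enum.
  rewrite (_ : W i = spare (Ordinal lt_i)); first exact: spareF.
  by apply: big_pred1 => h; rewrite /owned ib /= eq_sym.
by move=> x x' _ _; apply: VD.
Qed.

End Placed.

(** In every placement of the blocks, more than k rows are bad, or a block of size
    m + 1 is missing, or a row is missing even with a spare point added.  The weights
    k + 1 make the corresponding sum at least k + 1 in all three cases. *)
Lemma light_sets_force_missing :
  (k.+1%:R <= #|missing_star F L m|%:R / 'C(#|Z|, m.-1)%:R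
     + (k.+1 * s * #|missing F m.+1|)%:R / 'C(#|Z|, m.+1)%:R
     + (k.+1 * k * #|missing F m.+1|)%:R / 'C(#|Z|, m)%:R :> rat)%R.
Proof.
have [e eP eD] := blocks_exist blocks_fit.
pose K := (T + 'I_q + T * 'I_k)%type.
pose H (i : T) := [set E : {set T} | i |: E \in ~: F].
pose c (x : K) : nat := match x with
  | inl (inl i) => i \in L'
  | inl (inr _) => k.+1
  | inr ik => (ik.1 \in L') * k.+1 end.
pose b (x : K) : {set T} := match x with
  | inl y => e (inl y)
  | inr ik => e (inl (inl ik.1)) :|: e (inr ik.2) end.
pose sz (x : K) := match x with
  | inl y => block_size (inl y)
  | inr ik => (block_size (inl (inl ik.1))).+1 end.
pose G (x : K) := match x with
  | inl (inl i) => H i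
  | inl (inr _) => ~: F
  | inr ik => H ik.1 end.
have bP x : b x \subset Z /\ #|b x| = sz x.
  case: x => [y|[i h]]; first exact: eP.
  split; first by rewrite subUset !(eP _).1.
  have /leqifP := leq_card_setU (e (inl (inl i))) (e (inr h)).
  by rewrite eD // => /eqP->; rewrite !(eP _).2 addn1.
have : (k.+1%:R <= \sum_x (c x)%:R * density (G x) Z (sz x) :> rat)%R.
  apply: (averaging bP) => p pZ.
  under eq_bigr => x _ do rewrite -natrM.
  rewrite -natr_sum ler_nat !big_sumType /=.
  have peZ j : p @: e j \subset Z by apply: perm_on_imset (eP j).1.
  have main := bad_rows_gt peZ (disjoint_family_perm p eD).
  have [/forallP partF|] := boolP [forall j, p @: e (inl (inr j)) \in F]; last first.
    case/forallPn=> j jF; rewrite -addnA addnCA (bigD1 j) //= inE jF muln1.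
    by rewrite -!addnA leq_addr.
  have [/forallP spareF|] := boolP [forall ik : T * 'I_k, (ik.1 \in L') ==>
      (ik.1 |: (p @: e (inl (inl ik.1)) :|: p @: e (inr ik.2)) \in F)]; last first.
    case/forallPn=> ik; rewrite negb_imply => /andP[iL' ikF].
    rewrite addnC (bigD1 ik) //= iL' mul1n imsetU !inE ikF muln1.
    by rewrite -!addnA leq_addr.
  have := main partF; set bad := [set i in L' | _] => le_bad.
  apply: leq_trans (le_bad _) _ => [i h iL'|].
    by have /implyP/(_ iL') := spareF (i, h).
  apply: leq_trans (leq_addr _ _); apply: leq_trans (leq_addr _ _).
  rewrite -sum1_card big_mkcond /=; apply: leq_sum => i _.
  by rewrite !inE; case: (i \in U); case: (i \in L); case: (_ \in F).
have dLZ : [disjoint L & Z].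
  by rewrite disjoint_sym disjoints_subset setCS subsetUl.
have row_sum (d : nat) : (\sum_i (i \in L')%:R * density (H i) Z (if i \in L' then d else 0)%N
    <= #|[set B in ~: F | (#|B| == d.+1) && (#|B :&: L| == 1)]|%:R / 'C(#|Z|, d)%:R :> rat)%R.
  apply: le_trans (_ : (\sum_(i in L) density (H i) Z d <= _)%R).
    rewrite [X in (_ <= X)%R]big_mkcond; apply: ler_sum => i _.
    case: ifP => [iL'|_]; last by rewrite mul0r; case: ifP; rewrite ?divr_ge0 ?ler0n.
    by rewrite mul1r (subsetP (subsetDl L U) _ iL').
  rewrite -mulr_suml -natr_sum ler_wpM2r ?invr_ge0 ?ler0n // ler_nat.
  exact: star_slices_le.
rewrite !big_sumType /= => le_r; apply: le_trans le_r _; apply: lerD; first apply: lerD.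
- apply: le_trans (row_sum m.-1) _; rewrite ler_wpM2r ?invr_ge0 ?ler0n // ler_nat.
  by apply/subset_leq_card/subsetP => B; rewrite !inE prednK.
- rewrite sumr_const card_ord -[X in (X <= _)%R]mulr_natl /density !mulrA.
  rewrite ler_wpM2r ?invr_ge0 ?ler0n // -!natrM ler_nat [k.+1 * s]mulnC.
  apply: leq_mul; first by rewrite leq_mul2r /q; apply/orP; right; lia.
  by apply/subset_leq_card/subsetP => B; rewrite !inE => /and3P[-> _ ->].
have -> : (\sum_(ik : T * 'I_k) ((ik.1 \in L') * k.+1)%:R *
      density (H ik.1) Z (if ik.1 \in L' then m.-1 else 0)%N.+1
    = (k.+1 * k)%:R * \sum_i (i \in L')%:R * density (H i) Z (if i \in L' then m else 0)%N)%R.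
  transitivity (\sum_i \sum_(h < k) ((i \in L') * k.+1)%:R *
      density (H i) Z (if i \in L' then m.-1 else 0)%N.+1)%R.
    by rewrite pair_bigA.
  rewrite mulr_sumr; apply: eq_bigr => i _; rewrite sumr_const card_ord.
  case: ifP => _; last by rewrite mul0n !mul0r mulr0 mul0rn.
  by rewrite mul1n mul1r prednK // -[LHS]mulr_natl mulrA -natrM mulnC.
apply: le_trans (ler_wpM2l (ler0n _ _) (row_sum m)) _.
rewrite mulrA ler_wpM2r ?invr_ge0 ?ler0n // -natrM ler_nat.
apply: leq_mul => //.
by apply/subset_leq_card/subsetP => B; rewrite !inE => /and3P[-> ->].
Qed.

End LightSets.

(** * Extremal shifted families *)

Section ShiftedExtremal.
Variables m s l n : nat.
Variable F : {set {set 'I_n}}.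
Hypotheses (m_gt2 : 2 < m) (l_gt0 : 0 < l) (nE : n + l = m.+1 * s).
Hypothesis le_mln : 2 * m * l <= n.
Hypotheses (Fsh : shifted F) (Fs : ~ has_matching F s).

Let L := [set i : 'I_n | i < l.-1].
Let P := heavy m L.
Hypothesis le_PF : #|P| <= #|F|.

Let layer := [set A in F | #|A| == m].
Let low := [set A in F | (A \notin P) && (#|A| < m)].

(** From (2m+1)l <= (m+1)s; in particular s - l is of order s. *)
Lemma l_small : 3 * l <= 2 * s.
Proof. rewrite -(@leq_pmul2l (2 * m).+1) //; nia. Qed.

Lemma n_le : n <= m.+1 * s. Proof. by rewrite -nE leq_addr. Qed.

Lemma n_gt0 : 0 < n. Proof. by apply: leq_trans le_mln; rewrite !muln_gt0 l_gt0 /=; lia. Qed.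

Lemma card_L : #|L| = l.-1.
Proof. by apply: card_initial; move: le_mln; nia. Qed.

Lemma card_setC_F_le : #|~: F| <= #|~: P|.
Proof.
by have := cardsC P; rewrite -(cardsC F) => E; rewrite -(leq_add2l #|F|) -E leq_add2r.
Qed.

Lemma pow_n_le k : n ^ k <= m.+1 ^ k * s ^ k.
Proof. by rewrite -expnMn leq_exp_base // n_le. Qed.

Lemma missing_top_le : #|missing F m.+1| <= m.+1 ^ m.+1 * s ^ m.
Proof.
apply: (@leq_trans (m.+1 * n ^ m)).
  have n0 : 0 < #|'I_n| by rewrite card_ord n_gt0.
  have := card_lt_size_le m n0; rewrite card_ord; apply: leq_trans.
  apply: (@leq_trans #|~: F|).
    by apply/subset_leq_card/subsetP => A; rewrite !inE => /andP[].
  apply: leq_trans card_setC_F_le _; apply/subset_leq_card/subsetP => A.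
  by rewrite !inE -ltnNge; apply: leq_ltn_trans (leq_addr _ _).
by rewrite expnS -mulnA leq_mul2l pow_n_le orbT.
Qed.

Lemma missing_of_matching K : l + m * K < s -> s < m.+1 * (s - l - m * K) ->
  has_matching layer (l + m.+1 * K) -> K.+1 * 'C(s, m) <= #|missing F m.+1|.
Proof.
move=> lt_s le_s /(missing_ge_of_matching _ Fs lt_s); rewrite card_ord => /(_ nE).
by apply: leq_trans; rewrite leq_mul2l leq_bin2l ?orbT //; lia.
Qed.

(** K is chosen so that K + 1 exceeds the constant in [missing_top_le] divided by
    the constant in the lower bound for the binomial coefficient. *)
Lemma layer_matching_lt K : K = m`! * 2 ^ m * m.+1 ^ m.+1 ->
  3 * (m.+1 * (m * K)).+1 <= s -> 2 * m <= s ->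
  ~ has_matching layer (l + m.+1 * K).
Proof.
move=> KE le_Ks le_ms HM; have := l_small => le_ls.
have lt_s : l + m * K < s by nia.
have le_s : s < m.+1 * (s - l - m * K) by nia.
have := leq_trans (missing_of_matching lt_s le_s HM) missing_top_le.
have s_gt0 : 0 < s ^ m by rewrite expn_gt0; apply/orP; left; lia.
have := exp_le_bin le_ms; set c := m`! * 2 ^ m in KE *; move=> le1 le2.
have c_gt0 : 0 < c by rewrite muln_gt0 fact_gt0 expn_gt0.
have : K.+1 * s ^ m <= K * s ^ m.
  rewrite KE -/c -[c * _ * _]mulnA; apply: leq_trans (leq_mul (leqnn _) le1) _.
  by rewrite mulnA mulnC leq_mul2l -KE le2 orbT.
by rewrite leq_pmul2r // ltnn.
Qed.

Lemma P_compl_le : #|~: P| <= 'C(n - l.-1, m) + #|[set A in ~: P | #|A| < m]|.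
Proof.
have -> : 'C(n - l.-1, m) = #|[set A : {set 'I_n} | (A \subset ~: L) && (#|A| == m)]|.
  by rewrite cards_draws cardsCs setCK card_ord card_L.
apply: leq_trans (leq_card_setU _ _); apply/subset_leq_card/subsetP => A.
rewrite !inE -ltnNge => lt_A; rewrite lt_A /=; case: ltnP => [|le_m]; rewrite ?orbT //.
rewrite orbF -disjoints_subset -setI_eq0 -cards_eq0.
by move: lt_A le_m; move: #|A :&: L| #|A| => b a; lia.
Qed.

Lemma small_le (G : {set {set 'I_n}}) : (forall A, A \in G -> #|A| < m) ->
  #|G| <= m * m.+1 ^ m.-1 * s ^ m.-1.
Proof.
move=> Gm; apply: (@leq_trans (m * n ^ m.-1)).
  have n0 : 0 < #|'I_n| by rewrite card_ord n_gt0.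
  have := card_lt_size_le m.-1 n0; rewrite card_ord prednK; last by lia.
  by apply: leq_trans; apply/subset_leq_card/subsetP => A /Gm; rewrite inE.
by rewrite -mulnA leq_mul2l pow_n_le orbT.
Qed.

Lemma missing_layers_le :
  #|missing F m.+1| + #|missing F m| + #|[set A in ~: F | #|A| < m]| <= #|~: F|.
Proof.
rewrite -addnA; apply: (@leq_trans (#|missing F m.+1| + #|[set A in ~: F | #|A| <= m]|)).
  rewrite leq_add2l; apply: card_disjoint_le.
  - by apply/subsetP => A; rewrite !inE => /andP[-> /eqP->]; rewrite leqnn.
  - by apply/subsetP => A; rewrite !inE => /andP[-> /ltnW->].
  apply/setP => A; rewrite !inE; apply/negbTE/negP => /andP[/andP[_ /eqP->] /andP[_]].
  by rewrite ltnn.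
apply: card_disjoint_le.
- by apply/subsetP => A; rewrite !inE => /andP[].
- by apply/subsetP => A; rewrite !inE => /andP[].
apply/setP => A; rewrite !inE; apply/negbTE/negP => /andP[/andP[_ /eqP->] /andP[_]].
by rewrite ltnn.
Qed.

(** An l-matching in layer m forces a positive proportion of s^m missing
    (m+1)-sets.  Since [missing_layer_stability] holds for l + (m+1)K, all the sets
    gained in compensation number O(s^(m-1)). *)
Lemma no_layer_matching K : ~ has_matching layer (l + m.+1 * K) ->
  2 * m * (l + m.+1 * K) <= n -> 4 * m <= s ->
  m`! * 2 ^ m * ((m.+1 * K + m) * m.+1 ^ m.-1) < s ->
  ~ has_matching layer l.
Proof.
move=> noK le_Kn le_ms lt_s HM; have := l_small => le_ls.
have le1 : 1 * 'C(s, m) <= #|missing F m.+1|.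
  apply: (@missing_of_matching 0); rewrite ?muln0 ?addn0 //; nia.
have l'_gt0 : 0 < l + m.+1 * K by rewrite addn_gt0 l_gt0.
have m_gt1 : 1 < m by lia.
have := missing_layer_stability m_gt1 l'_gt0 le_Kn Fsh noK.
move/(leq_trans (leq_addr _ _)); rewrite leq_pmul2l; last by lia.
set c' := 'C(_, m) => le2.
have le3 : 'C(n - l.-1, m) <= c' + (m.+1 * K) * n ^ m.-1.
  have eqn : n - l.-1 = (n - (l + m.+1 * K).-1) + m.+1 * K by nia.
  have eqm : m = m.-1.+1 by lia.
  rewrite /c' eqn [in X in X <= _]eqm; apply: leq_trans (bin_add_le _ _ _) _.
  rewrite -eqm leq_add2l leq_mul2l -eqn leq_exp_base ?orbT //; lia.
have le4 : 'C(s, m) <= (m.+1 * K + m) * m.+1 ^ m.-1 * s ^ m.-1.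
  have h3 : #|[set A in ~: P | #|A| < m]| <= m * m.+1 ^ m.-1 * s ^ m.-1.
    by apply: small_le => A; rewrite inE => /andP[].
  have h5 := leq_mul (leqnn (m.+1 * K)) (pow_n_le m.-1).
  rewrite mulnA in h5; rewrite mulnDl mulnDl.
  have aux Cs Mt Mm y MF MP C x c N1 N2 N3 : 1 * Cs <= Mt -> c <= Mm -> C <= c + N1 ->
      MF <= MP -> MP <= C + x -> x <= N3 -> Mt + Mm + y <= MF -> N1 <= N2 ->
      Cs <= N2 + N3 by lia.
  exact: aux le1 le2 le3 card_setC_F_le P_compl_le h3 missing_layers_le h5.
have : s ^ m <= m`! * 2 ^ m * ((m.+1 * K + m) * m.+1 ^ m.-1) * s ^ m.-1.
  apply: leq_trans (exp_le_bin (_ : 2 * m <= s)) _; first by lia.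
  by rewrite mulnC -[X in _ <= X]mulnA leq_mul2l le4 orbT.
have eqm : m = m.-1.+1 by lia.
rewrite {1}eqm expnS leq_pmul2r; first by rewrite leqNgt lt_s.
by rewrite expn_gt0; apply/orP; left; lia.
Qed.

(** Compare missing sets layer by layer with those of P: layer m is settled by
    [missing_layer_stability], and below it the gains are the sets in [low]. *)
Lemma missing_le_low : ~ has_matching layer l ->
  m * #|missing F m.+1| + #|missing_star F L m| <= m * #|low|.
Proof.
move=> noM; have m_gt1 : 1 < m by lia.
have le1 := missing_layer_stability m_gt1 l_gt0 le_mln Fsh noM.
have le2 : #|[set A in ~: P | #|A| < m]| <= #|[set A in ~: F | #|A| < m]| + #|low|.
  apply: leq_trans (leq_card_setU _ _); apply/subset_leq_card/subsetP => A.
  rewrite !inE => /andP[-> ->].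
  by case: (A \in F).
have aux Mt Mm y MF MP C x X lo : m * C + X <= m * Mm -> x <= y + lo ->
    MF <= MP -> MP <= C + x -> Mt + Mm + y <= MF -> m * Mt + X <= m * lo.
  move=> h1 h2 h3 h4 h5; have : m * (Mt + Mm) <= m * (C + lo) by rewrite leq_mul2l; lia.
  by rewrite !mulnDr; lia.
exact: aux le1 le2 card_setC_F_le P_compl_le missing_layers_le.
Qed.

Lemma exp_le_of_bin_le c k : 2 * k.+1 <= s -> 'C(s, k.+1) <= c * s ^ k ->
  s <= c * (k.+1`! * 2 ^ k.+1).
Proof.
move=> le_ks le_C; have := leq_trans (exp_le_bin le_ks) (leq_mul le_C (leqnn _)).
by rewrite expnS mulnAC leq_pmul2r // expn_gt0; apply/orP; left; lia.
Qed.

(** The last two terms of [light_sets_force_missing] are each at most a quarter of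
    r + 1, so the first one is at least half of it. *)
Lemma missing_star_ge_of_matching r : r.+1 + l <= s -> r.+1 * m <= s ->
  4 * (s * #|missing F m.+1|) <= 'C(s, m.+1) -> 4 * (r * #|missing F m.+1|) <= 'C(s, m) ->
  has_matching [set A in F | #|A| + #|A :&: L| <= m] r.+1 ->
  r.+1 * 'C(s, m.-1) <= 2 * #|missing_star F L m|.
Proof.
move=> le_rl le_rm le_top le_layer [A AF AD].
have le_ls := l_small.
have AF' a : A a \in F by have := AF a; rewrite inE => /andP[].
have Aw a : #|A a| + #|A a :&: L| <= m by have := AF a; rewrite inE => /andP[].
have m_gt0 : 0 < m by lia.
have le_rL : r.+1 + #|L| <= s by rewrite card_L; lia.
have le_w : m.+1 * s + r <= #|'I_n| + #|L| + r.+1 by rewrite card_ord card_L -nE; lia.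
have := light_sets_force_missing AD Aw m_gt0 le_rL le_w Fs AF'.
have := card_Z_ge AD Aw; rewrite card_ord card_L.
set z := #|~: _| => le_z; set Mt := #|missing F m.+1| in le_top le_layer *.
have le_sz : s <= z by nia.
have C_gt0 k : k <= m.+1 -> 0 < 'C(z, k) by rewrite bin_gt0; nia.
have t2 : ((r.+1 * s * Mt)%:R / 'C(z, m.+1)%:R <= r.+1%:R / 4%:R :> rat)%R.
  rewrite ler_pdivrMr ?ltr0n ?C_gt0 // mulrAC ler_pdivlMr ?ltr0n // -!natrM ler_nat.
  have -> : r.+1 * s * Mt * 4 = r.+1 * (4 * (s * Mt)) by ring.
  by rewrite leq_mul2l (leq_trans le_top) ?orbT // leq_bin2l.
have t3 : ((r.+1 * r * Mt)%:R / 'C(z, m)%:R <= r.+1%:R / 4%:R :> rat)%R.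
  rewrite ler_pdivrMr ?ltr0n ?C_gt0 // mulrAC ler_pdivlMr ?ltr0n // -!natrM ler_nat.
  have -> : r.+1 * r * Mt * 4 = r.+1 * (4 * (r * Mt)) by ring.
  by rewrite leq_mul2l (leq_trans le_layer) ?orbT // leq_bin2l.
move=> le_r.
have : (r.+1%:R / 2%:R <= #|missing_star F L m|%:R / 'C(z, m.-1)%:R :> rat)%R by lra.
have m1_le : m.-1 <= m.+1 by lia.
rewrite ler_pdivlMr ?ltr0n ?C_gt0 // mulrAC ler_pdivrMr ?ltr0n // -!natrM ler_nat.
rewrite mulnC [_ * 2]mulnC; apply: leq_trans.
by rewrite mulnC leq_mul2r leq_bin2l ?orbT.
Qed.

(** r is chosen so that r + 1 disjoint sets in [low] would force more missing sets
    than the O(s^(m-1)) sets of [low] can compensate. *)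
Lemma no_low_matching r : ~ has_matching layer l ->
  r = m.-1`! * 2 ^ m.-1 * (2 * m * (m * m.+1 ^ m.-1)) ->
  3 * r.+1 <= s -> r.+1 * m <= s -> 2 * m.+1 <= s ->
  4 * (m * m.+1 ^ m.-1) * (m.+1`! * 2 ^ m.+1) < s ->
  4 * r * (m * m.+1 ^ m.-1) * (m`! * 2 ^ m) < s ->
  ~ has_matching low r.+1 /\ 
  forall A, A \in F -> A \notin P -> #|A| <= m -> 'C(s, m.-1) <= 2 * m * #|low|.
Proof.
move=> noM rE le_rs le_rm le_ms lt1 lt2; have le_ls := l_small.
have le_low := missing_le_low noM.
have low_le : #|low| <= m * m.+1 ^ m.-1 * s ^ m.-1.
  by apply: small_le => A; rewrite inE => /andP[_ /andP[]].
have Mt_le : #|missing F m.+1| <= m * m.+1 ^ m.-1 * s ^ m.-1.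
  apply: leq_trans low_le; rewrite -(@leq_pmul2l m); last by lia.
  exact: leq_trans (leq_addr _ _) le_low.
have eqm : m = m.-1.+1 by lia.
have top : 4 * (s * #|missing F m.+1|) <= 'C(s, m.+1).
  rewrite leqNgt; apply/negP => lt_C; have := ltnW lt_C.
  have le4 : 4 * (s * #|missing F m.+1|) <= 4 * (m * m.+1 ^ m.-1) * s ^ m.
    rewrite -mulnA leq_mul2l /= [in s ^ m]eqm expnS mulnCA leq_mul2l Mt_le orbT //.
  move/leq_trans/(_ le4)/(exp_le_of_bin_le le_ms); rewrite leqNgt.
  by rewrite lt1.
have lay : 4 * (r * #|missing F m.+1|) <= 'C(s, m).
  rewrite leqNgt; apply/negP => lt_C; have := ltnW lt_C.
  have le4 : 4 * (r * #|missing F m.+1|) <= 4 * r * (m * m.+1 ^ m.-1) * s ^ m.-1.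
    by rewrite !mulnA -!mulnA !leq_mul2l !mulnA Mt_le !orbT.
  rewrite [in 'C(s, m)]eqm => /leq_trans/(_ le4) le_C.
  have le_m : 2 * m.-1.+1 <= s by lia.
  by have := exp_le_of_bin_le le_m le_C; rewrite -eqm leqNgt lt2.
have low_P : low \subset [set A in F | #|A| + #|A :&: L| <= m].
  by apply/subsetP => A; rewrite !inE -ltnNge ltnS => /and3P[-> ->].
split.
  move=> /(has_matchingS low_P)/missing_star_ge_of_matching H.
  have {H} : r.+1 * 'C(s, m.-1) <= 2 * #|missing_star F L m| by apply: H => //; lia.
  have star_le : 2 * #|missing_star F L m| <= 2 * m * #|low|.
    by rewrite -mulnA leq_mul2l (leq_trans (leq_addl _ _) le_low) orbT.
  move/leq_trans/(_ star_le)/leq_trans/(_ (leq_mul (leqnn (2 * m)) low_le)) => le_r.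
  have le_m1 : 2 * m.-1 <= s by lia.
  have s_gt0 : 0 < s ^ m.-1 by rewrite expn_gt0; apply/orP; left; lia.
  have : r.+1 * s ^ m.-1 <= r * s ^ m.-1.
    apply: leq_trans (leq_mul (leqnn _) (exp_le_bin le_m1)) _; rewrite mulnA.
    by apply: leq_trans (leq_mul le_r (leqnn _)) _; rewrite rE; apply: eq_leq; ring.
  by rewrite leq_pmul2r // ltnn.
move=> A AF AP le_A.
have HM : has_matching [set A in F | #|A| + #|A :&: L| <= m] 1.
  exists (fun=> A) => [_|i j]; last by rewrite !ord1 eqxx.
  by rewrite inE AF; move: AP; rewrite inE -ltnNge ltnS.
have le_1l : 1 + l <= s by lia.
have le_1m : 1 * m <= s by lia.
have lay0 : 4 * (0 * #|missing F m.+1|) <= 'C(s, m) by rewrite mul0n muln0.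
have := missing_star_ge_of_matching le_1l le_1m top lay0 HM; rewrite mul1n => le_star.
apply: leq_trans le_star _.
by rewrite -mulnA leq_mul2l (leq_trans (leq_addl _ _) le_low) orbT.
Qed.

(** Without r + 1 disjoint members, [low] is covered by (r+1)m points and has
    O(s^(m-2)) members, fewer than a single light set requires. *)
Lemma F_eq_P r : ~ has_matching low r.+1 ->
  (forall A, A \in F -> A \notin P -> #|A| <= m -> 'C(s, m.-1) <= 2 * m * #|low|) ->
  2 * m <= s ->
  2 * m * (r.+1 * m * (m.-1 * m.+1 ^ m.-2)) * (m.-1`! * 2 ^ m.-1) < s ->
  F = P.
Proof.
move=> no_low force le_ms lt_s; apply/eqP; rewrite eqEcard le_PF andbT.
apply/subsetP => A AF; rewrite -[_ \in _]negbK; apply/negP => AP.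
have le_A : #|A| <= m.
  by move: AP; rewrite inE -ltnNge ltnS; apply: leq_trans; apply: leq_addr.
have [|C le_C CP] := @cover_of_no_matching _ low r.+1 m _ no_low.
  by move=> B; rewrite inE => /andP[_ /andP[_ /ltnW]].
have n0 : 0 < #|'I_n| by rewrite card_ord n_gt0.
have eqm : m = m.-2.+2 by lia.
have low_le : #|low| <= r.+1 * m * (m.-1 * m.+1 ^ m.-2) * s ^ m.-2.
  have : #|low| <= #|C| * (m.-2.+1 * n ^ m.-2).
    rewrite -[n in n ^ _]card_ord; apply: (card_le_cover n0) => B BG.
    by split; [move: BG; rewrite -eqm inE => /andP[_ /andP[]] | apply: CP].
  move/leq_trans; apply; rewrite -[X in _ <= X]mulnA; apply: leq_mul => //.
  rewrite -mulnA; apply: leq_mul; [lia | exact: pow_n_le].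
have := force A AF AP le_A.
move/leq_trans/(_ (leq_mul (leqnn (2 * m)) low_le)); rewrite mulnA.
have -> : m.-1 = m.-2.+1 by lia.
move=> le_bin; have le_m : 2 * m.-2.+1 <= s by lia.
have := exp_le_of_bin_le le_m le_bin; rewrite leqNgt.
by rewrite (_ : m.-2.+1 = m.-1) ?lt_s //; lia.
Qed.

End ShiftedExtremal.

Lemma shifted_extremal m : 2 < m -> exists C s0, forall s l n, s0 <= s -> 0 < l ->
  n + l = m.+1 * s -> 2 * m * l + C <= n ->
  forall F : {set {set 'I_n}}, shifted F -> ~ has_matching F s ->
  let P := heavy m [set i : 'I_n | i < l.-1] in
  #|P| <= #|F| -> F = P.
Proof.
move=> m_gt2.
pose K := m`! * 2 ^ m * m.+1 ^ m.+1.
pose r := m.-1`! * 2 ^ m.-1 * (2 * m * (m * m.+1 ^ m.-1)).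
pose c1 := 3 * (m.+1 * (m * K)).+1.
pose c2 := m`! * 2 ^ m * ((m.+1 * K + m) * m.+1 ^ m.-1).
pose c3 := 4 * (m * m.+1 ^ m.-1) * (m.+1`! * 2 ^ m.+1).
pose c4 := 4 * r * (m * m.+1 ^ m.-1) * (m`! * 2 ^ m).
pose c5 := 2 * m * (r.+1 * m * (m.-1 * m.+1 ^ m.-2)) * (m.-1`! * 2 ^ m.-1).
exists (2 * m * (m.+1 * K)), (c1 + c2 + c3 + c4 + c5 + 3 * r.+1 + r.+1 * m + 4 * m.+1).+1.
move=> s l n le_s l_gt0 nE le_n F Fsh Fs P le_PF.
have le_mln : 2 * m * l <= n by apply: leq_trans le_n; apply: leq_addr.
have noK : ~ has_matching [set A in F | #|A| == m] (l + m.+1 * K).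
  by apply: (layer_matching_lt m_gt2 l_gt0 nE le_mln Fs le_PF) => //; rewrite -?/c1; lia.
have noM : ~ has_matching [set A in F | #|A| == m] l.
  apply: (no_layer_matching m_gt2 l_gt0 nE le_mln Fsh Fs le_PF noK); rewrite -?/c2; lia.
have [|||||no_low force] := no_low_matching m_gt2 l_gt0 nE le_mln Fsh Fs le_PF noM (erefl r);
  rewrite -?/c3 -?/c4; try lia.
apply: (F_eq_P m_gt2 l_gt0 nE le_mln le_PF no_low force); rewrite -?/c5; lia.
Qed.

(** * Undoing a shift *)

Section Unshifting.
Variables (m s l n : nat).
Hypotheses (m_gt0 : 0 < m) (le_ls : l <= s) (nE : n + l = m.+1 * s).
Hypothesis n_large : 3 * m.+2 + l <= n.
Variable F : {set {set 'I_n}}.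
Hypothesis Fs : ~ has_matching F s.
Implicit Types (L A B X Y : {set 'I_n}).

Variables (i j : 'I_n) (L : {set 'I_n}).
Hypotheses (card_L : #|L| = l.-1) (shF : shift i j F = heavy m L).

(** Let L1 be L without i.  For L1 both X and Y have weight at most m, and the
    remaining points split exactly into sets of weight at least m + 1 that avoid i and
    j.  Those sets are in F because the shift does not affect them, and together
    with X and Y they form a matching of size s. *)
Lemma crossing_disjoint X Y : i \in L -> j \notin L ->
  i \in X -> X \in F -> #|X| + #|X :&: L| = m.+1 ->
  j \in Y -> Y \in F -> #|Y| + #|Y :&: L| = m -> ~~ [disjoint X & Y].
Proof.
move=> iL jL iX XF wX jY YF wY; apply/negP => dXY.
have l_gt1 : 1 < l by have := cardsD1 i L; rewrite iL card_L add1n; lia.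
pose L1 := L :\ i.
have cL1 : #|L1| = l.-2 by have := cardsD1 i L; rewrite iL card_L add1n /L1 => ->.
pose A (a : 'I_2) := if a == ord0 then X else Y.
have AF a : A a \in F by rewrite /A; case: ifP.
have AD : disjoint_family A.
  move=> a b; rewrite /A -!val_eqE /=; have := ltn_ord a; have := ltn_ord b.
  by case: (val a) => [|[|//]]; case: (val b) => [|[|//]] //=; rewrite disjoint_sym.
have Aw a : #|A a| + #|A a :&: L1| <= m.
  rewrite /A; case: ifP => _.
    have := cardsD1 i (X :&: L); rewrite in_setI iX iL add1n -setIDA -/L1 => cXL.
    by move: wX; rewrite cXL addnS => -[->]; rewrite leqnn.
  by rewrite -wY leq_add2l subset_leq_card // setIS // subsetDl.
have le_rL : 2 + #|L1| <= s by rewrite cL1; lia.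
have le_w : m.+1 * s + 0 <= #|'I_n| + #|L1| + 2 by rewrite card_ord cL1; lia.
(* No spare point: a single bad row contradicts the choice of the blocks. *)
have [e eP eD] := blocks_exist (blocks_fit AD Aw m_gt0 le_rL le_w).
have eZ x := (eP x).1.
pose U := \bigcup_a A a.
have iU : i \in U by apply/bigcupP; exists ord0.
have jU : j \in U by apply/bigcupP; exists ord_max.
have offU B : i \notin B -> j \notin B -> m.+1 <= #|B| + #|B :&: L| -> B \in F.
  move=> iB jB wB; have : B \in shift i j F by rewrite shF inE.
  by rewrite inE (negPf iB) (negPf jB) eqxx.
have Uout x u : u \in U -> u \notin e x.
  by move=> uU; apply/negP => /(subsetP (eZ x)); rewrite !inE uU orbT.
have gt := bad_rows_gt AD m_gt0 le_rL le_w Fs AF eZ eD.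
have partF h : e (inl (inr h)) \in F.
  by apply: offU; rewrite ?Uout // (eP _).2 leq_addr.
have /card_gt0P[x] := gt partF (fun x h => ltac:(by case: h)).
rewrite inE => /andP[xL' /negP]; case.
have := xL'; rewrite !inE => /and3P[xU xi xL].
have nx u : u \in U -> u \notin x |: e (inl (inl x)).
  move=> uU; rewrite in_setU1 negb_or Uout // andbT.
  by apply: contraNneq xU => <-.
apply: offU; rewrite ?nx //.
have xe : x \notin e (inl (inl x)).
  by apply/negP => /(subsetP (eZ _)); rewrite !inE xi xL.
rewrite cardsU1 xe (eP _).2 [in if _ then _ else _]xL' add1n prednK // -addn1 leq_add2l.
by apply/card_gt0P; exists x; rewrite inE setU11.
Qed.

Lemma card_swap_setI A : #|swap i j A :&: L| = #|A :&: swap i j L|.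
Proof.
rewrite -(card_imset (swap i j A :&: L) (@perm_inj _ (tperm i j))).
rewrite imsetI; last by move=> x y _ _; apply: perm_inj.
by rewrite -[in RHS](swapK i j A).
Qed.

Lemma card_swap A : #|swap i j A| = #|A|.
Proof. by rewrite card_imset //; apply: perm_inj. Qed.

(** If the shift moved no set, F is [heavy m L].  Otherwise some heavy A0 containing
    i arose from a set of F containing j.  Every heavy A with i that is light
    after the swap has weight exactly m + 1, and all of these must come from the
    same side, by comparison with a third one C disjoint from A and A0 except at
    i: two on opposite sides would contradict [crossing_disjoint].  So all of them
    come from the j side and F is heavy for the swapped L. *)
Lemma unshift_heavy : exists2 L' : {set 'I_n}, #|L'| = l.-1 & F = heavy m L'.
Proof.
have room w : w <= m.+1 + m.+1 + l.-1 + 1 -> m.-1 <= n - w by lia.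
have wdiff a b (p q : bool) : m.+1 <= a + (p + b) -> ~~ (m.+1 <= a + (q + b)) ->
    [/\ p, ~~ q, a + (p + b) = m.+1 & a + (q + b) = m].
  by case: p; case: q => /= h1 h2; split=> //; lia.
have mem_sh A : (A \in heavy m L) = if (i \in A) == (j \in A) then A \in F
    else if j \in A then (A \in F) && (swap i j A \in F)
    else (A \in F) || (swap i j A \in F).
  by rewrite -shF inE.
have swI A : (i \in swap i j A) = (j \in A) by rewrite in_swap tpermL.
have swJ A : (j \in swap i j A) = (i \in A) by rewrite in_swap tpermR.
have [/forallP all_i|] := boolP [forall A : {set 'I_n},
    [&& i \in A, j \notin A & A \in heavy m L] ==> (A \in F)].
  exists L => //; apply/setP => A; rewrite mem_sh.
  case: eqP => // neq; have := all_i A; have := all_i (swap i j A).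
  rewrite !mem_sh !swI !swJ swapK.
  move: neq; case: (i \in A); case: (j \in A) => //=.
    by move=> _ _; case: (A \in F); case: (swap _ _ _ \in F).
  by move=> _; case: (A \in F); case: (swap _ _ _ \in F).
case/forallPn=> A0; rewrite negb_imply => /andP[/and3P[iA0 jA0 A0P] A0F].
have sA0F : swap i j A0 \in F.
  by move: A0P; rewrite mem_sh iA0 (negPf jA0) (negPf A0F).
have light A : i \in A -> j \notin A -> ~~ ((A \in F) && (swap i j A \in F)) ->
    swap i j A \notin heavy m L.
  move=> iA jA; rewrite mem_sh swI swJ iA (negPf jA) /= swapK.
  by case: (A \in F); case: (swap _ _ _ \in F).
have swE A : i \in A -> j \notin A -> swap i j A = j |: (A :\ i).
  by move=> iA jA; rewrite /swap tpermC; apply: swapE.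
have wswap A : i \in A -> j \notin A -> #|swap i j A :&: L| = (j \in L) + #|(A :\ i) :&: L|.
  move=> iA jA; rewrite swE // setIUl.
  have [jL|jL] := boolP (j \in L).
    have -> : [set j] :&: L = [set j] by apply/setIidPl; rewrite sub1set.
    by rewrite cardsU1 !inE (negPf jA) andbF.
  have -> : [set j] :&: L = set0.
    by apply/eqP; rewrite setI_eq0 disjoint_sym disjoints_subset subsetC sub1set inE.
  by rewrite set0U.
have wA A : i \in A -> #|A :&: L| = (i \in L) + #|(A :\ i) :&: L|.
  by move=> iA; rewrite (cardsD1 i) inE iA /= setIDAC.
have diff A : i \in A -> j \notin A -> A \in heavy m L -> swap i j A \notin heavy m L ->
    [/\ i \in L, j \notin L, #|A| + #|A :&: L| = m.+1 &
      #|swap i j A| + #|swap i j A :&: L| = m].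
  move=> iA jA; rewrite !inE card_swap wswap // wA //.
  exact: wdiff.
have [iL jL wA0 wsA0] := diff A0 iA0 jA0 A0P (light A0 iA0 jA0 ltac:(by rewrite (negPf A0F))).
have keep A : i \in A -> j \notin A -> A \in F -> swap i j A \in F.
  move=> iA jA AF; apply/negPn/negP => sAF.
  have AP : A \in heavy m L by rewrite mem_sh iA (negPf jA) AF.
  have [_ _ wAA wsA] := diff A iA jA AP (light A iA jA ltac:(by rewrite (negPf sAF) andbF)).
  pose W := A :|: A0 :|: L :|: [set j].
  have [C0 sC0 cC0] : exists2 C0 : {set 'I_n}, C0 \subset ~: W & #|C0| = m.-1.
    have cW : m.-1 <= #|~: W|.
      rewrite cardsCs setCK card_ord; apply: room.
      apply: leq_trans (leq_card_setU _ _) _; rewrite cards1 leq_add2r.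
      apply: leq_trans (leq_card_setU _ _) _; rewrite card_L leq_add2r.
      apply: leq_trans (leq_card_setU _ _) _.
      by apply: leq_add; [rewrite -wAA | rewrite -wA0]; apply: leq_addr.
    have [|e eP _] := @blocks_exist _ 'I_1 (fun=> m.-1) (~: W).
      by rewrite big_ord1.
    by exists (e ord0); have [] := eP ord0.
  have outC0 x : x \in C0 -> [/\ x \notin A, x \notin A0, x \notin L & x != j].
    by move/(subsetP sC0); rewrite !inE !negb_or -!andbA => /and4P[].
  have iC0 : i \notin C0 by apply/negP => /outC0[]; rewrite iA.
  have jC0 : j \notin C0 by apply/negP => /outC0[]; rewrite eqxx.
  pose C := i |: C0.
  have iC : i \in C by apply: setU11.
  have jC : j \notin C by rewrite !inE negb_or jC0 andbT; apply: contraNneq jL => ->.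
  have CL : #|C :&: L| = 1.
    rewrite wA // iL /C setU1K //; have -> : C0 :&: L = set0; last by rewrite cards0.
    by apply/eqP; rewrite setI_eq0 disjoints_subset; apply/subsetP => x /outC0[_ _ xL _]; rewrite inE.
  have wC : #|C| + #|C :&: L| = m.+1 by rewrite CL cardsU1 iC0 cC0 add1n prednK // addn1.
  have wsC : #|swap i j C| + #|swap i j C :&: L| = m.
    have := wA C iC; rewrite CL iL add1n => -[cC].
    rewrite card_swap wswap // (negPf jL) add0n -cC.
    by rewrite cardsU1 iC0 cC0 add1n prednK // addn0.
  have dC B : (forall x, x \in C0 -> x \notin B) -> i \notin B -> [disjoint C & B].
    move=> CB iB; rewrite disjoints_subset subUset sub1set inE iB.
    by apply/subsetP => x /CB; rewrite inE.
  have CP : C \in heavy m L by rewrite inE wC.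
  have swC : swap i j C = j |: C0 by rewrite swE // setU1K.
  move: CP; rewrite mem_sh iC (negPf jC) /= => /orP[CF|sCF].
    have := @crossing_disjoint C (swap i j A0) iL jL iC CF wC; rewrite swJ iA0 sA0F.
    move=> /(_ isT isT wsA0); rewrite dC //; last by rewrite swI.
    move=> x /outC0[_ xA0 _ xj]; rewrite swE // !inE negb_or xj negb_and xA0 orbT.
    by [].
  have := @crossing_disjoint A (swap i j C) iL jL iA AF wAA; rewrite swJ iC sCF.
  move=> /(_ isT isT wsC); rewrite swC disjoints_subset.
  case/negP; apply/subsetP => x xA; rewrite !inE negb_or; apply/andP; split.
    by apply: contraNneq jA => <-.
  by apply/negP => /outC0[]; rewrite xA.
exists (swap i j L); first by rewrite card_swap.
apply/setP => A; rewrite [RHS]inE -card_swap_setI -(card_swap A).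
have -> : (m < #|swap i j A| + #|swap i j A :&: L|) = (swap i j A \in heavy m L) by rewrite inE.
rewrite mem_sh swI swJ swapK eq_sym.
have [eqA|] := altP (i \in A =P (j \in A)); first by rewrite swap_id.
have := keep A; have := keep (swap i j A); rewrite swI swJ swapK.
case: (i \in A); case: (j \in A) => //=.
  by move=> _ kA _; case AF: (A \in F) kA => [] //; [move=> ->|rewrite andbF].
by move=> kA _ _; case sF: (swap i j A \in F) kA => [] // ->.
Qed.

End Unshifting.

(** * From shifted families to all families *)

(** Induction on the number of shifts needed, measured by [index_sum]. *)
Lemma extremal_no_matching m : 2 < m -> exists C s0, forall s l n,
  s0 <= s -> 0 < l -> n + l = m.+1 * s -> 2 * m * l + C <= n ->
  forall F : {set {set 'I_n}}, ~ has_matching F s ->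
  let P := heavy m [set i : 'I_n | i < l.-1] in
  #|F| <= #|P| /\
  (#|F| = #|P| -> exists2 L : {set 'I_n}, #|L| = l.-1 & F = heavy m L).
Proof.
move=> m_gt2; have [C [s0 core]] := shifted_extremal m_gt2.
exists C, (s0 + 3 * m.+2) => s l n le_s l_gt0 nE le_n F Fs P.
have le_mln : 2 * m * l <= n by apply: leq_trans le_n; apply: leq_addr.
have le_l : 3 * l <= 2 * s by rewrite -(@leq_pmul2l (2 * m).+1) //; nia.
have n_large : 3 * m.+2 + l <= n by nia.
have le_s0 : s0 <= s by lia.
elim: {F}(index_sum F).+1 {-2}F (ltnSn (index_sum F)) Fs => // w IHw F lt_w Fs.
have [Fsh|not_sh] : shifted F \/ exists (i j : 'I_n) (A : {set 'I_n}),
    [/\ i < j, A \in F, j \in A, i \notin A & swap i j A \notin F].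
  have [/forallP sh|] := boolP [forall i : 'I_n, forall j : 'I_n, forall A : {set 'I_n},
      [&& i < j, A \in F, j \in A & i \notin A] ==> (swap i j A \in F)].
    left=> i j A lt_ij AF jA iA; rewrite -swapE //.
    by have /forallP/(_ j)/forallP/(_ A) := sh i; rewrite lt_ij AF jA iA.
  case/forallPn=> i /forallPn[j /forallPn[A]]; rewrite negb_imply.
  by case/andP=> /and4P[? ? ? ?] ?; right; exists i, j, A.
  have FP := core s l n le_s0 l_gt0 nE le_n F Fsh Fs.
  split=> [|eqFP].
    by rewrite leqNgt; apply/negP => lt_PF; move: (lt_PF); rewrite (FP (ltnW lt_PF)) ltnn.
  exists [set i : 'I_n | i < l.-1]; last by apply: FP; rewrite eqFP leqnn.
  by apply: card_initial; nia.
have [i [j [A [lt_ij AF jA iA sAF]]]] := not_sh.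
have [|/contra_not|le_P eq_P] := IHw (shift i j F).
- by apply: leq_trans (index_sum_shift lt_ij AF jA iA sAF) _.
- by move/(_ _ (@has_matching_shift _ _ _ _ _)); apply.
rewrite card_shift in le_P eq_P; split=> // /eq_P[L cL shF].
have m_gt0 : 0 < m by lia.
have le_ls : l <= s by lia.
exact (unshift_heavy m_gt0 le_ls nE n_large Fs cL shF).
Qed.

Lemma trivIset_matching (T : finType) (I : finType) (M : I -> {set T}) :
  disjoint_family M -> (forall i, M i != set0) ->
  trivIset (M @: setT) /\ #|M @: setT| = #|I|.
Proof.
move=> MD M0; have injM : injective M.
  move=> i j eqM; apply/eqP/negPn/negP => /MD; rewrite eqM -setI_eq0 setIid.
  exact/negP.
split; last by rewrite card_imset // cardsT.
apply/trivIsetP => _ _ /imsetP[i _ ->] /imsetP[j _ ->] neq.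
by apply: MD; apply: contra_neq neq => ->.
Qed.

Lemma no_matching_without_set0 (T : finType) (F : {set {set T}}) s :
  matching_number F < s -> set0 \notin F -> ~ has_matching F s.
Proof.
move=> lt_s F0 [M MF MD].
have M0 i : M i != set0 by apply: contraNneq F0 => <-.
have [tM cM] := trivIset_matching MD M0.
have : is_matching F (M @: setT).
  by rewrite /is_matching tM andbT; apply/subsetP => _ /imsetP[i _ ->].
move/(@leq_bigmax_cond _ (is_matching F) (fun S : {set {set T}} => #|S|)) => /=.
by rewrite cM card_ord -/(matching_number F) leqNgt lt_s.
Qed.

Lemma no_matching_remove_set0 (T : finType) (F : {set {set T}}) s :
  matching_number F < s.+1 -> set0 \in F -> ~ has_matching (F :\ set0) s.
Proof.
move=> lt_s F0 [M MF MD].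
have M0 i : M i != set0 by have := MF i; rewrite !inE => /andP[].
have [tM cM] := trivIset_matching MD M0.
have notin : set0 \notin M @: setT.
  by apply/imsetP => -[i _ /esym/eqP]; rewrite (negPf (M0 i)).
have : is_matching F (set0 |: M @: setT).
  rewrite /is_matching subUset sub1set F0 /=; apply/andP; split.
    by apply/subsetP => _ /imsetP[i _ ->]; have := MF i; rewrite !inE => /andP[].
  have d0 (A : {set T}) : A \in M @: setT -> [disjoint set0 & A].
    by rewrite disjoints_subset sub0set.
  by have [] := trivIsetU1 d0 tM notin.
move/(@leq_bigmax_cond _ (is_matching F) (fun S : {set {set T}} => #|S|)) => /=.
by rewrite cardsU1 notin cM card_ord -/(matching_number F) leqNgt lt_s.
Qed.

(** Removing the empty set lowers the matching number, so all sets through one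
    point x may be added.  Some x brings at least two new sets, [set x] and
    [set x; y]; otherwise disjoint pairs would yield a large matching. *)
Lemma larger_family (T : finType) (F : {set {set T}}) s :
  2 * s <= #|T| -> matching_number F < s.+1 -> set0 \in F ->
  exists2 G : {set {set T}}, #|F| < #|G| & ~ has_matching G s.+1.
Proof.
move=> le_s lt_s F0; set F' := F :\ set0.
have F's := no_matching_remove_set0 lt_s F0.
have [x [y [neq_xy xF xyF]]] : exists x y,
    [/\ x != y, [set x] \notin F' & [set x; y] \notin F'].
  have [|/forallPn noxy] := boolP [forall x, forall y,
      (x != y) ==> ([set x] \in F') || ([set x; y] \in F')]; last first.
    have [x /forallPn[y]] := noxy; rewrite negb_imply negb_or => /and3P[? ? ?].
    by exists x, y.
  move/forallP=> all_xy; case: F's.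
  have [|e eP eD] := @blocks_exist _ 'I_s (fun=> 2) [set: T].
    by rewrite sum_nat_const card_ord cardsT mulnC.
  have /fin_all_exists2[M MF sMe] : forall i, exists2 A, A \in F' & A \subset e i.
    move=> i; have [_ /eqP ce] := eP i; have /cards2P[x [y [neq_xy eE]]] := ce.
    have /forallP/(_ y) := all_xy x; rewrite neq_xy => /orP[]; last first.
      by exists [set x; y]; rewrite // eE.
    by exists [set x]; rewrite // eE sub1set !inE eqxx.
  exists M => // i j neq_ij; apply: disjointWl (sMe i) _.
  by apply: disjointWr (sMe j) _; apply: eD.
exists (F' :|: [set A : {set T} | x \in A]).
  rewrite (cardsD1 set0 F) F0 add1n -/F'.
  apply: (@leq_trans #|[set x] |: ([set x; y] |: F')|).
    rewrite !cardsU1 xyF in_setU1 negb_or xF andbT.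
    have -> : [set x] != [set x; y].
      apply: contra neq_xy => /eqP/setP/(_ y); rewrite !inE eqxx orbT eq_sym.
      by move->.
    by [].
  apply/subset_leq_card/subsetP => A; rewrite !in_setU1 => /or3P[/eqP->|/eqP->|AF]; apply/setUP.
  - by right; rewrite inE set11.
  - by right; rewrite inE set21.
  - by left.
case=> M MG MD; apply: F's.
apply: (@has_matching_in _ _ _ _ [pred i | x \notin M i] M) => [|i|i j _ _]; last exact: MD.
  have cE : #|[pred i | x \notin M i]| + #|[predC [pred i | x \notin M i]]| = s.+1.
    by rewrite cardC card_ord.
  suff le1 : #|[predC [pred i | x \notin M i]]| <= 1.
    move: cE le1; set a := #|_|; set b := #|_|; clear; lia.
  apply/card_le1_eqP => i j; rewrite !inE !negbK => xi xj.
  exact: disjoint_family_eq MD xj xi.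
by rewrite inE => xi; have := MG i; rewrite in_setU inE (negPf xi) orbF.
Qed.
Local Open Scope ring_scope.

Theorem theorem1p3 (R : realType) (m : nat) (eps : R)
    (hm : (3 <= m)%N) (heps : 0 < eps) :
  exists s0 : nat, forall s : nat, (s0 <= s)%N ->
  forall l : nat, (1 <= l)%N ->
    l%:R <= (m.+1%:R / (2 * m + 1)%N%:R - eps) * s%:R ->
  forall F : {set {set 'I_(ground m s l)}},
    (matching_number F < s)%N ->
    (#|F| <= sizeP m s l)%N /\
    (#|F| = sizeP m s l <->
     exists L : {set 'I_(ground m s l)}, #|L| = l.-1 /\ F = famP L).
Proof.
have [C [s0 extremal]] := extremal_no_matching hm.
exists (s0 + Num.bound (C%:R / eps) + 2)%N => s le_s l l_gt0 le_l F F_lt.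
have le_C : (2 * m * l + C + l <= m.+1 * s)%N.
  have C_le : C%:R <= eps * s%:R.
    rewrite mulrC -ler_pdivrMr //.
    apply: (le_trans (ltW (archi_boundP _))); first by rewrite divr_ge0 ?ler0n ?ltW.
    by rewrite ler_nat (leq_trans _ le_s) // -addnA addnCA leq_addr.
  have m_gt0 : 0 < (2 * m + 1)%N%:R :> R by rewrite ltr0n addn1.
  have m_ge1 : 1 <= (2 * m + 1)%N%:R :> R by rewrite ler1n addn1.
  rewrite -(ler_nat R).
  have : (2 * m + 1)%N%:R * l%:R <= m.+1%:R * s%:R - (2 * m + 1)%N%:R * (eps * s%:R) :> R.
    have := ler_wpM2l (ltW m_gt0) le_l; rewrite mulrBl mulrBr.
    by rewrite [X in _ <= X - _]mulrA mulrCA mulfV ?lt0r_neq0 // mulr1 mulrA.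
  have : C%:R <= (2 * m + 1)%N%:R * (eps * s%:R) :> R.
    apply: le_trans C_le _; rewrite ler_peMl // mulr_ge0 ?ler0n //; exact: ltW.
  rewrite !natrD !natrM; lra.
have nE : (ground m s l + l = m.+1 * s)%N by rewrite /ground subnK //; lia.
have le_n : (2 * m * l + C <= ground m s l)%N by lia.
have le_s0 : (s0 <= s)%N by lia.
have main := extremal s l _ le_s0 l_gt0 nE le_n.
have heavyE (L : {set 'I_(ground m s l)}) : heavy m L = famP L by [].
have P_eq : #|heavy m [set i : 'I_(ground m s l) | (i < l.-1)%N]| = sizeP m s l by [].
have [F0|F0] := boolP (set0 \in F); last first.
  have [le_F eq_F] := main F (no_matching_without_set0 F_lt F0).
  rewrite P_eq in le_F eq_F.
  split=> //; split=> [/eq_F[L cL ->]|[L [cL ->]]]; first by exists L.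
  exact: card_famP.
have s_gt0 : (0 < s)%N by lia.
have [||G lt_FG Gs] := @larger_family _ F s.-1 _ _ F0; rewrite ?prednK //.
  have le_ls : (l <= s)%N by rewrite -(@leq_pmul2l (2 * m).+1) //; nia.
  have le_3s : (3 * s <= m * s)%N by rewrite leq_mul2r hm orbT.
  by move: nE; rewrite card_ord mulSn; lia.
rewrite prednK // in Gs; have [le_G _] := main G Gs.
have lt_F : (#|F| < sizeP m s l)%N by rewrite -P_eq; apply: leq_trans lt_FG le_G.
split; first exact: ltnW.
split=> [eq_F|[L [cL FE]]]; first by rewrite eq_F ltnn in lt_F.
by rewrite FE (card_famP cL) ltnn in lt_F.
Qed.
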